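(* For every $n=1,2,3,\dots$: 1. The Weyl polynomial $W^{\infty}_{\partial B^{n+1}}$ of infinite index, as well as the Weyl polynomials $W^{p}_{\partial B^{n+1}}$ of arbitrary finite index $p=1,2,\dots$, related to the boundary surface of the ball $B^{n+1}$, are conservative. 2. The Weyl polynomials $W^{p}_{\partial(B^{n}\times 0)}$ of index $p=1$, $p=2$ and $p=4$, related to the boundary surface of the squeezed spherical cylinder $B^n\times 0$, are conservative. 3. The Weyl polynomial $W^{\infty}_{\partial Q^{n+1}}$ of infinite index, as well as the Weyl polynomials $W^{p}_{\partial Q^{n+1}}$ of arbitrary finite index $p=1,2,\dots$, related to the boundary surface of the cube $Q^{n+1}$, are conservative. 4. The Weyl polynomial $W^{\infty}_{\partial(Q^{n}\times 0)}$ of infinite index, as well as the Weyl polynomials $W^{p}_{\partial(Q^{n}\times 0)}$ of arbitrary finite index $p=1,2,\dots$, related to the boundary surface of the squeezed cubic cylinder $Q^n\times 0$, are conservative.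
   Context: $B^n=\{x\in\mathbb{R}^n:\sum_{k=1}^n|x_k|^2\le 1\}$ is the unit ball and $Q^n=\{x\in\mathbb{R}^n:\max_{1\le k\le n}|x_k|\le 1\}$ is the unit cube. For $V\subset\mathbb{R}^n$, $V\times 0=\{(x,0):x\in V\}\subset\mathbb{R}^{n+1}$. For a compact convex $U\subset\mathbb{R}^{n+1}$ (possibly with empty interior), the Minkowski polynomial is $M_U^{\mathbb{R}^{n+1}}(t)=\mathrm{Vol}_{n+1}(U+tB^{n+1})=\sum_{k=0}^{n+1} m_k^{\mathbb{R}^{n+1}}(U)t^k$ ($t\ge0$; this is a polynomial in $t$). The Weyl coefficients attached to $\partial U$ are $$k_{2l}(\partial U)=2^l\frac{\Gamma(l+\frac12+1)}{\Gamma(\frac12+1)}\,m_{2l+1}^{\mathbb{R}^{n+1}}(U),\qquad 0\le l\le [n/2],$$ the Weyl polynomial of index $p$ is $$W^p_{\partial U}(t)=\sum_{l=0}^{[n/2]}\frac{2^{-l}\Gamma(\frac p2+1)}{\Gamma(\frac p2+l+1)}k_{2l}(\partial U)t^{2l},$$ and the Weyl polynomial of infinite index is $W^\infty_{\partial U}(t)=\sum_{l=0}^{[n/2]}k_{2l}(\partial U)t^{2l}$, all considered for complex $t$. (When $U$ has empty interior, $\partial U$ is only a symbol, and these objects are attached to $U\subset\mathbb{R}^{n+1}$.) A polynomial is conservative if all its (complex) roots are purely imaginary (lie in $\{z:\mathrm{Re}\,z=0\}$) and simple. *)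

(* Defs.v *)
From mathcomp Require Import all_boot all_order all_algebra.
From mathcomp Require Import all_classical all_reals all_analysis.
From mathcomp Require Import complex.

Set Implicit Arguments.
Unset Strict Implicit.
Unset Printing Implicit Defensive.

Import Order.TTheory GRing.Theory Num.Theory.
Import numFieldNormedType.Exports.

Local Open Scope classical_set_scope.
Local Open Scope ring_scope.

(* The n-fold product of the one-dimensional Lebesgue measure, built through
   R^{m+1} = R x R^m; as for any product measure in the library, its values are
   meaningful on measurable (Borel) sets. *)
Fixpoint lebesgue_tuple (R : realType) (n : nat) :
    set (n.-tuple (measurableTypeR R)) -> \bar R :=
  match n with
  | 0 => \d_([tuple] : 0.-tuple (measurableTypeR R))
  | m.+1 => pushforward (lebesgue_measure \x @lebesgue_tuple R m)%E
              (fun p => [tuple of p.1 :: p.2])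
  end.

Definition volume (R : realType) (n : nat) (A : set 'rV[R]_n) : \bar R :=
  lebesgue_tuple [set t : n.-tuple (measurableTypeR R) |
                   A (\row_(i < n) tnth t i)].

Definition unit_ball (R : realType) (n : nat) : set 'rV[R]_n :=
  [set x | \sum_(k < n) `|x 0 k| ^+ 2 <= 1].

Definition unit_cube (R : realType) (n : nat) : set 'rV[R]_n :=
  [set x | forall k : 'I_n, `|x 0 k| <= 1].

(* V x 0: [col' ord_max x] drops the last coordinate of x. *)
Definition squeezed (R : realType) (n : nat) (V : set 'rV[R]_n) :
    set 'rV[R]_n.+1 :=
  [set x | V (col' ord_max x) /\ x 0 ord_max = 0].

Definition parallel_body (R : realType) (n : nat) (U : set 'rV[R]_n) (t : R) :
    set 'rV[R]_n :=
  [set x + t *: y | x in U & y in @unit_ball R n].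

(* The volume determines the polynomial; the default 0 is only reached when
   the volume of the parallel bodies is not polynomial in t. *)
Definition minkowski_poly (R : realType) (n : nat) (U : set 'rV[R]_n) :
    {poly R} :=
  xget 0 [set M : {poly R} | (size M <= n.+1)%N /\
    forall t, 0 <= t -> volume (parallel_body U t) = (M.[t])%:E].

Definition Gamma (R : realType) (x : R) : R :=
  \int[lebesgue_measure]_(t in `]0, +oo[) (t `^ (x - 1) * expR (- t)).

(* The coefficient k_{2l} attached to the boundary of U in R^{n+1}. *)
Definition weyl_coef (R : realType) (n : nat) (U : set 'rV[R]_n.+1)
    (l : nat) : R :=
  2 ^+ l * (Gamma (l%:R + 2^-1 + 1) / Gamma (2^-1 + 1 : R)) *
  (minkowski_poly U)`_(l.*2.+1).

Definition weyl_poly (R : realType) (n p : nat) (U : set 'rV[R]_n.+1) :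
    {poly R} :=
  \sum_(0 <= l < (n./2).+1)
    ((2 ^- l * Gamma (p%:R / 2 + 1)) / Gamma (p%:R / 2 + l%:R + 1) *
     weyl_coef U l) *: 'X^(l.*2).

Definition weyl_poly_infty (R : realType) (n : nat) (U : set 'rV[R]_n.+1) :
    {poly R} :=
  \sum_(0 <= l < (n./2).+1) weyl_coef U l *: 'X^(l.*2).

(* The complex roots of P are purely imaginary and simple; the zero polynomial
   is not conservative. *)
Definition conservative (R : realType) (P : {poly R}) : Prop :=
  let PC := map_poly (real_complex R) P in
  forall z : R[i], root PC z -> complex.Re z = 0 /\ mup z PC = 1%N.

(* Main.v *)
Require Import Defs.

From HB Require Import structures.
From mathcomp Require Import all_boot all_order all_algebra.
From mathcomp Require Import all_classical all_reals all_analysis.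
From mathcomp Require Import measurable_realfun complex polyrcf ring lra zify.

Set Implicit Arguments.
Unset Strict Implicit.
Unset Printing Implicit Defensive.
Import Order.TTheory GRing.Theory Num.Theory.
Import numFieldNormedType.Exports.
Local Open Scope classical_set_scope.
Local Open Scope ring_scope.
Local Open Scope complex_scope.

(** Every polynomial of the theorem is even, of the form q(t^2).  Call a complex
    polynomial axial when its nonzero roots are imaginary and simple; the task
    is to show that the q(t^2) are axial and that q(0) is not 0.

    Finite index.  By Gamma(x+1) = x Gamma(x), passing from W^oo to W^p divides
    the coefficient of t^(2l) by (p+2)(p+4)...(p+2l).  This operator preserves
    axial polynomials ([axial_weyl_multiplier]): q is a product of linear factors
    x + a with a > 0, and including one more factor turns T, the polynomial of
    index p+2 of the remaining factors, into (t^2 + g) T + a t T' up to a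
    constant, with g >= 0.  Why such an operation keeps roots imaginary: with r_i
    the roots of T, the quotient of the new polynomial by t T is
    H(t) = t + g/t + a sum_i 1/(t - r_i), whose real part is Re t times a positive
    number; and H' is positive at the zeros of H, which gives simplicity.  The
    general form of this argument is [axial_pencil].

    Coefficients.  In all four cases the parallel body is described by sums of
    functions of single coordinates, so its volume is computed by integrating one
    coordinate at a time.  An interval of half-length 1 acts on polynomials in t
    by 2 + J and a coordinate of a ball, or a squeezed one, by J, where J sends
    t^k to kappa_k t^(k+1) and kappa_k is the integral of (1-s^2)^(k/2) over
    [-1,1].  With omega_n = kappa_0 ... kappa_(n-1), the Minkowski polynomials of
    B^n, Q^n, Q^n x 0 and B^n x 0 are omega_n (1+t)^n, (2+J)^n 1, (2+J)^n J 1 and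
    J (omega_n (1+t)^n).

    Roots.  For the ball, W^oo is a reversed Hermite polynomial at an imaginary
    argument, and its three-term recursion is again a pencil
    ([axial_hermite_square]).  For the cubes, (k+2) kappa_(k+1) kappa_k does not
    depend on k, hence W^oo is the odd or even part of a power of 1 + b t, and
    the Hermite-Biehler argument applies: when all roots of a real G lie in the
    open left half-plane, those of its even and odd parts are imaginary and simple
    ([axial_even_part], [axial_odd_part]).  For the squeezed ball, W^p is the sum
    of the C(n,2l) b_l t^(2l), where b_0 = 1 and (p+2l+2) b_(l+1) = (2l+2) b_l.
    When p is 1 or 2, this is the even part of the sum of the C(n,k) a_k t^k for
    numbers a_k that average the moments of a positive measure on [0,1], and such
    a sum has its roots in the left half-plane ([axial_moment_even]).  When p = 4,
    b_l = 2/((l+1)(l+2)), and sign changes at explicit points -tan(phi)^2 exhibit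
    all the roots of q ([axial_kernel4]). *)

(** * Axial polynomials and pencils *)

(** The root 0 is left out because the steps below may create it; even
    polynomials with nonzero constant term do not have it. *)
Definition axial (R : rcfType) (P : {poly R[i]}) : Prop :=
  forall z, z != 0 -> root P z -> complex.Re z = 0 /\ P^`().[z] != 0.

Section ComplexParts.
Variable R : rcfType.
Implicit Types (z u : R[i]) (x w : R).

Lemma ReD z u : complex.Re (z + u) = complex.Re z + complex.Re u.
Proof. by case: z; case: u. Qed.

Lemma ReB z u : complex.Re (z - u) = complex.Re z - complex.Re u.
Proof. by case: z; case: u. Qed.

Lemma Re_sum I (r : seq I) (P : pred I) (F : I -> R[i]) :
  complex.Re (\sum_(i <- r | P i) F i) = \sum_(i <- r | P i) complex.Re (F i).
Proof. by apply: (big_morph _ ReD). Qed.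

Lemma ReZ x z : complex.Re (x%:C * z) = x * complex.Re z.
Proof. by case: z => a b /=; rewrite mul0r subr0. Qed.

(** The squared modulus, as an element of [R] rather than of [R[i]]. *)
Definition sqn z : R := complex.Re z ^+ 2 + complex.Im z ^+ 2.

Lemma sqn_ge0 z : 0 <= sqn z.
Proof. by rewrite addr_ge0 ?sqr_ge0. Qed.

Lemma sqn_gt0 z : z != 0 -> 0 < sqn z.
Proof.
move=> z0; rewrite lt_neqAle sqn_ge0 andbT eq_sym.
apply: contra z0; rewrite paddr_eq0 ?sqr_ge0// !sqrf_eq0.
by case: z => a b /= /andP[/eqP-> /eqP->].
Qed.

Lemma Re_div x z : complex.Re (x%:C / z) = x / sqn z * complex.Re z.
Proof.
case: z => a b; rewrite /sqn /= mul0r subr0.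
by rewrite -mulrA; congr (_ * _); rewrite mulrC.
Qed.

Lemma Re0_eq z : complex.Re z = 0 -> z = (complex.Im z)%:C * 'i.
Proof. by case: z => a b /= ->; simpc. Qed.

Lemma Re0_sqr z : complex.Re z = 0 -> z ^+ 2 = - (sqn z)%:C.
Proof.
move=> z0; rewrite /sqn z0 expr0n/= add0r {1}(Re0_eq z0) exprMn sqr_i rmorphXn/=.
by rewrite mulrN1.
Qed.

Lemma Re_div_sqr x z : complex.Re z = 0 -> x%:C / z ^+ 2 = - (x / sqn z)%:C.
Proof. by move=> z0; rewrite Re0_sqr// invrN mulrN -fmorphV -rmorphM. Qed.

End ComplexParts.

Lemma deriv_prod (A : comNzRingType) (I : eqType) (s : seq I) (F : I -> {poly A}) :
  uniq s -> (\prod_(i <- s) F i)^`() =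
    \sum_(i <- s) (F i)^`() * \prod_(j <- s | j != i) F j.
Proof.
elim: s => [|b s IH] /=; first by rewrite !big_nil derivC.
case/andP=> bs us; rewrite !big_cons eqxx/= derivM IH//; congr (_ * _ + _).
  rewrite big_seq [RHS]big_seq_cond; apply: eq_bigl => j.
  by case: eqVneq => [->|//]; rewrite ?andbT // (negPf bs).
rewrite mulr_sumr [LHS]big_seq [RHS]big_seq; apply: eq_bigr => i iS.
rewrite big_cons; case: eqVneq => [bi|_]; first by rewrite bi iS in bs.
by rewrite mulrCA.
Qed.

Section Pencil.
Variable R : rcfType.

Lemma poly_split (P : {poly R[i]}) : P != 0 ->
  exists m (c : R[i]) (r : 'I_m -> R[i]), [/\ c != 0, P = c *: \prod_i ('X - (r i)%:P)
   & size P = m.+1].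
Proof.
move=> P0; have [s Ps] := closed_field_poly_normal P.
exists (size s), (lead_coef P), (fun i => tnth (in_tuple s) i).
rewrite lead_coef_eq0; split => //.
  by rewrite {1}Ps; congr (_ *: _); rewrite big_tnth.
by rewrite Ps size_scale ?lead_coef_eq0// size_prod_XsubC.
Qed.

Variables (m : nat) (c : R[i]) (r : 'I_m -> R[i]).
Let P := c *: \prod_i ('X - (r i)%:P).
Let Pd i := c *: \prod_(j | j != i) ('X - (r j)%:P).

Lemma mul_cofactor i : ('X - (r i)%:P) * Pd i = P.
Proof. by rewrite /P [in RHS](bigD1 i)//= /Pd -scalerAr. Qed.

Lemma deriv_sum_cofactors : P^`() = \sum_i Pd i.
Proof.
rewrite /P derivZ deriv_prod ?index_enum_uniq// scaler_sumr.
by apply: eq_bigr => i _; rewrite derivXsubC mul1r.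
Qed.

Hypotheses (c0 : c != 0) (r_im : forall i, complex.Re (r i) = 0).
Variables (w : 'I_m -> R) (a g k : R).
Hypotheses (w0 : forall i, 0 <= w i) (w_gt0 : forall i, r i != 0 -> 0 < w i).
Hypotheses (a0 : 0 <= a) (g0 : 0 <= g) (ag0 : 0 < a + g).
Let U := (a%:C%:P * 'X^2 + (k *i)%:P * 'X + g%:C%:P) * P
         + 'X * \sum_i (w i)%:C%:P * Pd i.

(** Dividing [U] by [X P] leaves H(z) = a z + i k + g/z + sum_i w_i/(z - r_i).
    Since the r_i are imaginary, Re 1/(z - r_i) = Re z / |z - r_i|^2, so that
    Re H(z) = Re z * B with B = a + g/|z|^2 + sum_i w_i/|z - r_i|^2 > 0, and a
    root of [U] is imaginary.  A common root of [U] and [P] is excluded by the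
    simplicity of the roots of [P] and by [w_gt0]. *)
Lemma axial_pencil : axial P -> axial U.
Proof.
move=> axP z z0 /rootP Uz.
have UE t : U.[t] = (a%:C * t ^+ 2 + (k *i) * t + g%:C) * P.[t]
     + t * \sum_i (w i)%:C * (Pd i).[t].
  rewrite /U !hornerE horner_sum; congr (_ + _ * _).
  by apply: eq_bigr => i _; rewrite !hornerE.
have Pz : P.[z] != 0.
  apply/negP => /eqP Pz; have [rez P'z] := axP _ z0 (introT rootP Pz).
  have [i zi] : exists i, z = r i.
    move/eqP: Pz; rewrite /P hornerE mulf_eq0 (negPf c0)/= horner_prod.
    by rewrite prodf_seq_eq0 => /hasP[i _ /=]; rewrite !hornerE subr_eq0 => /eqP; exists i.
  have Pdj j : j != i -> (Pd j).[z] = 0.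
    move=> ji; rewrite /Pd hornerE horner_prod (bigD1 i) 1?eq_sym//=.
    by rewrite hornerXsubC {1}zi subrr mul0r mulr0.
  move: P'z; rewrite deriv_sum_cofactors horner_sum (bigD1 i)//= big1 ?addr0// => Pdi.
  move/eqP: Uz; rewrite UE Pz mulr0 add0r (bigD1 i)//= big1 ?addr0; last first.
    by move=> j ji; rewrite Pdj// mulr0.
  rewrite !mulf_eq0 (negPf z0) (negPf Pdi) orbF/=.
  by rewrite -(rmorph0 (real_complex R)) (inj_eq (@complexI R)) gt_eqF// w_gt0// -zi.
have zr i : z - r i != 0.
  apply: contra Pz => /eqP zr; rewrite -(mul_cofactor i) hornerM.
  by rewrite hornerXsubC zr mul0r.
have PdE i : (Pd i).[z] = P.[z] / (z - r i).
  by rewrite -(mul_cofactor i) hornerM hornerXsubC mulrAC mulfV// mul1r.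
pose S := \sum_i (w i)%:C / (z - r i).
have SE : \sum_i (w i)%:C * (Pd i).[z] = P.[z] * S.
  by rewrite mulr_sumr; apply: eq_bigr => i _; rewrite PdE mulrCA.
have H0 : a%:C * z + (k *i) + g%:C / z + S = 0.
  have : z * P.[z] * (a%:C * z + (k *i) + g%:C / z + S) = 0.
    rewrite -[RHS]Uz UE.
    by rewrite SE; field.
  by move/eqP; rewrite !mulf_eq0 (negPf z0) (negPf Pz) => /eqP.
pose B := a + g / sqn z + \sum_i w i / sqn (z - r i).
have B_gt0 : 0 < B.
  apply: ltr_wpDr; first by apply: sumr_ge0 => i _; rewrite divr_ge0 ?sqn_ge0.
  have := sqn_gt0 z0 => sz; move: a0; rewrite le_eqVlt => /predU1P[a00|agt].
    by rewrite -a00 add0r divr_gt0//; move: ag0; rewrite -a00 add0r.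
  by rewrite ltr_pwDl// divr_ge0 ?sqn_ge0.
have rez : complex.Re z = 0.
  have := congr1 (@complex.Re R) H0.
  rewrite !ReD ReZ !Re_div Re_sum /=.
  under eq_bigr do rewrite Re_div ReB r_im subr0.
  rewrite -mulr_suml addr0 -!mulrDl => /eqP.
  by rewrite mulf_eq0 (gt_eqF B_gt0) => /eqP.
split => //.
(* U = X P H and H(z) = 0, so U'(z) = z P(z) H'(z); as z and the r_i are imaginary,
   the squares in H'(z) = a - g/z^2 - sum_i w_i/(z - r_i)^2 are negative and H'(z) = B. *)
have dPd i : (Pd i)^`().[z] = P^`().[z] / (z - r i) - P.[z] / (z - r i) ^+ 2.
  have := congr1 (fun p : {poly R[i]} => p^`().[z]) (mul_cofactor i).
  rewrite /= derivM derivXsubC mul1r hornerD hornerM hornerXsubC PdE => <-.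
  by field; rewrite zr.
have dU : U^`().[z] = P^`().[z] * (z * (a%:C * z + (k *i) + g%:C / z + S))
    + P.[z] * (2%:R * a%:C * z + (k *i) + S)
    - z * P.[z] * \sum_i (w i)%:C / (z - r i) ^+ 2.
  have dA : (a%:C%:P * 'X^2 + (k *i)%:P * 'X + g%:C%:P)^`() =
      2%:R * a%:C%:P * 'X + (k *i)%:P.
    by rewrite !poly.derivE; ring.
  rewrite /U derivD derivM dA derivM derivX mul1r (raddf_sum (@deriv R[i])) /=.
  rewrite !(hornerD, hornerM, hornerX, hornerC, hornerXn, horner_sum).
  have -> : \sum_i ((w i)%:C%:P * Pd i).[z] = P.[z] * S.
    by rewrite -SE; apply: eq_bigr => i _; rewrite hornerM hornerC.
  have -> : \sum_i ((w i)%:C%:P * Pd i)^`().[z] =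
      P^`().[z] * S - P.[z] * \sum_i (w i)%:C / (z - r i) ^+ 2.
    rewrite !mulr_sumr -sumrB; apply: eq_bigr => i _.
    by rewrite derivM derivC mul0r add0r hornerM hornerC dPd; ring.
  set Q := \sum_i _.
  by field.
have Q0 : \sum_i (w i)%:C / (z - r i) ^+ 2 = - (\sum_i w i / sqn (z - r i))%:C.
  rewrite rmorph_sum -sumrN; apply: eq_bigr => i _.
  by rewrite Re_div_sqr// ReB rez r_im subrr.
have g2 : g%:C / z ^+ 2 = - (g / sqn z)%:C by rewrite Re_div_sqr.
have -> : U^`().[z] = z * P.[z] * B%:C.
  rewrite dU H0 !mulr0 add0r Q0.
  have -> : 2%:R * a%:C * z + k *i + S = z * (a%:C - g%:C / z ^+ 2).
    transitivity (a%:C * z - g%:C / z + (a%:C * z + k *i + g%:C / z + S)); first by ring.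
    by rewrite H0; field.
  by rewrite g2 /B !rmorphD/=; ring.
rewrite !mulf_neq0//.
by rewrite -(rmorph0 (real_complex R)) (inj_eq (@complexI R)) gt_eqF.
Qed.

End Pencil.

(** The operation P |-> (1 + n X^2) P - X^3 P' is the conjugate of Q |-> X Q + Q'
    under the reversal Q(X) = X^n P(1/X).  Writing P' as the sum of the cofactors
    of the m roots shows that it is a pencil with weights -r_i^2, which are
    positive for imaginary nonzero r_i. *)
Lemma pencil_reverse (A : comNzRingType) m n (X P : A) (Pd r s : 'I_m -> A) :
  (m <= n)%N -> (forall i, (X - r i) * Pd i = P) -> (forall i, s i = - r i ^+ 2) ->
  ((n - m)%:R * X ^+ 2 + (- \sum_i r i) * X + 1) * P + X * \sum_i s i * Pd i =
  (1 + n%:R * X ^+ 2) * P - X ^+ 3 * \sum_i Pd i.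
Proof.
move=> mn PdP sE.
have -> : \sum_i s i * Pd i =
      (m%:R * X + \sum_i r i) * P - X ^+ 2 * \sum_i Pd i.
  have -> : m%:R * X + \sum_i r i = \sum_i (X + r i).
    by rewrite big_split/= sumr_const card_ord mulr_natl.
  rewrite mulr_sumr mulr_suml -sumrB; apply: eq_bigr => i _.
  by rewrite sE -(PdP i); ring.
by rewrite natrB//; ring.
Qed.

Section AxialSteps.
Variable R : rcfType.
Implicit Types P : {poly R[i]}.

Lemma axial_neq0 P : axial P -> P != 0.
Proof.
move=> axP; apply/eqP => P0; have [] := axP 1 (oner_neq0 _).
  by rewrite P0 root0.
by move=> /= /eqP; rewrite oner_eq0.
Qed.

Lemma axial_Re P z : axial P -> root P z -> complex.Re z = 0.
Proof. by move=> axP Pz; have [->//|z0] := eqVneq z 0; have [] := axP z z0 Pz. Qed.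

Lemma axial_step P (g h : R) : axial P -> 0 <= g -> 0 < h ->
  axial (('X^2 + g%:C%:P) * P + h%:C%:P * 'X * P^`()).
Proof.
move=> axP g0 h0.
have [m [c [r [c0 Pr _]]]] := poly_split (axial_neq0 axP).
rewrite {}Pr in axP *; rewrite deriv_sum_cofactors.
have r_im i : complex.Re (r i) = 0.
  apply: (axial_Re axP); by rewrite -(mul_cofactor c r i) rootM root_XsubC eqxx.
have := @axial_pencil R m c r c0 r_im (fun=> h) 1 g 0 (fun=> ltW h0)
  (fun _ _ => h0) ler01 g0 (ltr_pwDl ltr01 g0) axP.
congr (axial (_ + _)); first by congr ((_ + _) * _); rewrite !rmorph1 mul0r addr0 mul1r.
by rewrite -mulr_sumr; ring.
Qed.

Lemma axial_reverse_step P n : axial P -> (size P <= n.+1)%N ->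
  axial ((1 + n%:R *: 'X^2) * P - 'X^3 * P^`()).
Proof.
move=> axP sP.
have [m [c [r [c0 Pr Psz]]]] := poly_split (axial_neq0 axP).
have mn : (m <= n)%N by rewrite Psz in sP.
rewrite {}Pr {sP Psz} in axP *; rewrite deriv_sum_cofactors.
have r_im i : complex.Re (r i) = 0.
  apply: (axial_Re axP); by rewrite -(mul_cofactor c r i) rootM root_XsubC eqxx.
have := @axial_pencil R m c r c0 r_im (fun i => sqn (r i)) (n - m)%:R 1
  (- \sum_i complex.Im (r i)) (fun=> sqn_ge0 _)
  (fun i => @sqn_gt0 R (r i)) (ler0n _ _) ler01 (ltr_wpDl (ler0n _ _) ltr01) axP.
congr axial.
have kE : ((- \sum_i complex.Im (r i)) *i)%:P = - \sum_i (r i)%:P :> {poly R[i]}.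
  rewrite -rmorph_sum -polyCN -sumrN -[in RHS]sumrN; congr _%:P.
  apply: (big_rec2 (fun x y => x *i = y)) => // i x y _ <-.
  by rewrite [in RHS](Re0_eq (r_im i)); simpc.
rewrite kE !rmorph1 !rmorph_nat.
rewrite (@pencil_reverse _ m n 'X (c *: \prod_i ('X - (r i)%:P)) _ (fun i => (r i)%:P)
  (fun i => (sqn (r i))%:C%:P)) //.
- by rewrite scaler_nat mulr_natl.
- by move=> i; apply: mul_cofactor.
- by move=> i; rewrite -polyC_exp Re0_sqr// polyCN opprK.
Qed.

End AxialSteps.

(** * Even polynomials and the multiplier of finite index *)

Section EvenPolynomials.
Variable R : rcfType.
Implicit Types (p q : {poly R}).

Definition even_lift q : {poly R[i]} := map_poly (real_complex R) (q \Po 'X^2).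

Lemma even_liftE q z : (even_lift q).[z] = (map_poly (real_complex R) q).[z ^+ 2].
Proof. by rewrite /even_lift map_comp_poly map_polyXn horner_comp hornerXn. Qed.

Lemma even_liftD p q : even_lift (p + q) = even_lift p + even_lift q.
Proof. by rewrite /even_lift comp_polyD rmorphD. Qed.

Lemma even_liftZ c q : even_lift (c *: q) = c%:C *: even_lift q.
Proof. by rewrite /even_lift comp_polyZ linearZ. Qed.

Lemma even_liftXM q : even_lift ('X * q) = 'X^2 * even_lift q.
Proof. by rewrite /even_lift comp_polyM comp_polyX rmorphM/= map_polyXn. Qed.

Lemma deriv_even_lift q : (even_lift q)^`() = 2 *: ('X * even_lift q^`()).
Proof.
rewrite /even_lift deriv_map deriv_comp derivXn rmorphM/= rmorphMn/= map_polyX.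
by rewrite scaler_nat mulrnAr mulrC.
Qed.

Lemma axialZ (c : R[i]) P : c != 0 -> axial P -> axial (c *: P).
Proof.
move=> c0 axP z z0; rewrite rootZ// => rz; have [? dz] := axP z z0 rz.
by split=> //; rewrite derivZ hornerZ mulf_neq0.
Qed.

(** A root of [q] is t^2 for some imaginary t, hence a negative real number. *)
Lemma even_lift_linear_factors q : axial (even_lift q) -> q`_0 != 0 ->
  exists (c : R) (a : seq R), [/\ c != 0, all (fun x => 0 < x) a &
    q = c *: \prod_(x <- a) ('X + x%:P)].
Proof.
move=> axq q0.
have qn0 : q != 0 by apply: contraNneq q0 => ->; rewrite coef0.
have [s qs] := closed_field_poly_normal (map_poly (real_complex R) q).
have sP z : z \in s -> complex.Re z < 0 /\ z = (complex.Re z)%:C.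
  move=> zs; pose t := sqrtc z.
  have t2 : t ^+ 2 = z by rewrite /t sqr_sqrtc.
  have rqz : root (map_poly (real_complex R) q) z.
    by rewrite qs rootZ ?lead_coef_eq0 ?map_poly_eq0// root_prod_XsubC.
  have t0 : t != 0.
    apply: contraNneq q0 => t0; move: rqz; rewrite -t2 t0 expr0n/= => /rootP.
    by rewrite horner_coef0 coef_map => /eqP; rewrite fmorph_eq0.
  have [|Ret _] := axq t t0; first by apply/rootP; rewrite even_liftE t2; apply/rootP.
  rewrite -t2 Re0_sqr// -rmorphN; split => //=.
  by rewrite oppr_lt0 sqn_gt0.
exists (lead_coef q), [seq - complex.Re z | z <- s]; split.
- by rewrite lead_coef_eq0.
- by apply/allP => _ /mapP[z zs ->]; rewrite oppr_gt0; case: (sP _ zs).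
apply: (map_poly_inj (real_complex R)).
rewrite [LHS]qs lead_coef_map linearZ/=; congr (_ *: _).
rewrite big_map rmorph_prod/= !big_seq; apply: eq_bigr => z /sP[_ zE].
by rewrite {1}zE rmorphD/= map_polyX map_polyC/= rmorphN polyCN.
Qed.

End EvenPolynomials.

Section Multiplier.
Variable R : rcfType.
Implicit Types (p : R) (q : {poly R}).

(** The ratio 2^l Gamma(p/2 + l + 1) / Gamma(p/2 + 1). *)
Definition rising p l : R := \prod_(i < l) (p + i.+1.*2%:R).

Lemma risingS p l : rising p l.+1 = rising p l * (p + l.+1.*2%:R).
Proof. by rewrite /rising big_ord_recr. Qed.

Lemma risingSl p l : rising p l.+1 = (p + 2) * rising (p + 2) l.
Proof.
rewrite /rising big_ord_recl; congr (_ * _); apply: eq_bigr => i _.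
by rewrite -addrA -natrD; congr (_ + _%:R); rewrite /bump; lia.
Qed.

Lemma rising_gt0 p l : 0 <= p -> 0 < rising p l.
Proof. by move=> p0; apply: prodr_gt0 => i _; rewrite ltr_wpDl// ltr0n double_gt0. Qed.

Definition weyl_multiplier p q := \poly_(l < size q) (q`_l / rising p l).

Lemma coef_weyl_multiplier p q l : (weyl_multiplier p q)`_l = q`_l / rising p l.
Proof.
rewrite coef_poly; case: ltnP => // ql.
by rewrite nth_default// mul0r.
Qed.

Lemma weyl_multiplierZ p c q : weyl_multiplier p (c *: q) = c *: weyl_multiplier p q.
Proof. by apply/polyP => l; rewrite coefZ !coef_weyl_multiplier coefZ mulrA. Qed.

(** The index p of a product with one more linear factor is computed from the
    index p + 2 of the product without it: this is why the induction of
    [axial_weyl_multiplier_prod] has to vary p. *)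
Lemma weyl_multiplier_XaddC p a q : 0 <= p ->
  (p + 2) *: weyl_multiplier p (('X + a%:P) * q) =
  'X * weyl_multiplier (p + 2) q + a *: ((p + 2) *: weyl_multiplier (p + 2) q
    + 2 *: ('X * (weyl_multiplier (p + 2) q)^`())).
Proof.
move=> p0; apply/polyP => l.
rewrite !(coefZ, coefD) !coefXM coef_deriv !coef_weyl_multiplier.
rewrite [('X + a%:P) * q]mulrDl coefD coefXM coefCM.
have p2 : 0 < p + 2 by rewrite ltr_wpDl.
case: l => [|l] /=.
  by rewrite /rising !big_ord0; field.
have rl : rising (p + 2) l != 0 by rewrite gt_eqF// rising_gt0 ?ltW.
have l2 : p + 2 + l.+1.*2%:R != 0 by rewrite gt_eqF// ltr_wpDr.
rewrite risingSl risingS.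
have dE : (l.+1.*2)%:R = l.+1%:R * 2 :> R by rewrite -muln2 natrM.
rewrite -[_ *+ l.+1]mulr_natr dE in l2 *.
move: rl; move: (rising (p + 2) l) => D D0.
move: p2 l2; move: (p + 2) (l.+1%:R : R) => b k b0 bk.
by field; rewrite D0 bk gt_eqF.
Qed.

Lemma axial_weyl_multiplier_prod p (a : seq R) : 0 <= p -> all (fun x => 0 < x) a ->
  axial (even_lift (weyl_multiplier p (\prod_(x <- a) ('X + x%:P)))).
Proof.
move=> p0; elim: a p p0 => [|a s IH] p p0 /=.
  move=> _ z z0; rewrite big_nil => /rootP; rewrite even_liftE.
  have -> : weyl_multiplier p 1 = 1.
    apply/polyP => l; rewrite coef_weyl_multiplier coef1.
    by case: l => [|l]; rewrite ?mul0r// /rising big_ord0 divr1.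
  by rewrite rmorph1 hornerC => /eqP; rewrite oner_eq0.
case/andP => a0 s0; rewrite big_cons.
have p2 : 0 < p + 2 by rewrite ltr_wpDl.
have := IH _ (ltW p2) s0; set Q := \prod_(_ <- _) _; set T := weyl_multiplier _ Q => axT.
have := @axial_step R (even_lift T) (a * (p + 2)) a axT (ltW (mulr_gt0 a0 p2)) a0.
have -> : ('X^2 + (a * (p + 2))%:C%:P) * even_lift T + a%:C%:P * 'X * (even_lift T)^`()
   = (p + 2)%:C *: even_lift (weyl_multiplier p (('X + a%:P) * Q)).
  rewrite -even_liftZ weyl_multiplier_XaddC// -/T deriv_even_lift.
  rewrite !(even_liftD, even_liftZ, even_liftXM) -!mul_polyC rmorphM polyCM.
  rewrite !rmorph_nat.
  move: (even_lift T) (even_lift _) => A B.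
  by ring.
have p2C : (p + 2)%:C^-1 != 0 by rewrite invr_eq0 fmorph_eq0 gt_eqF.
move=> /(axialZ p2C); rewrite scalerA mulVf ?scale1r//.
by move: p2C; rewrite invr_eq0.
Qed.

Lemma axial_weyl_multiplier p q : 0 <= p -> q`_0 != 0 ->
  axial (even_lift q) -> axial (even_lift (weyl_multiplier p q)).
Proof.
move=> p0 q0 axq; have [c [a [c0 apos ->]]] := even_lift_linear_factors axq q0.
rewrite weyl_multiplierZ even_liftZ; apply: axialZ; first by rewrite fmorph_eq0.
exact: axial_weyl_multiplier_prod.
Qed.

End Multiplier.

(** * The ball: Hermite polynomials *)

Section Hermite.
Variable R : rcfType.

Definition odd_fact l : R := \prod_(i < l) i.*2.+1%:R.

(** With n-th polynomial q, x^n q(1/x^2) is i^(-n) He_n(i x), for He_n the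
    Hermite polynomial that satisfies He_(n+1) = x He_n - He_n'; l counts the
    pairs of a partial matching of n points. *)
Definition hermite_square n : {poly R} := \poly_(l < (n./2).+1) ('C(n, l.*2)%:R * odd_fact l).

Lemma coef_hermite_square n l : (hermite_square n)`_l = 'C(n, l.*2)%:R * odd_fact l.
Proof.
rewrite coef_poly ltnS; case: leqP => // nl.
by rewrite bin_small ?mul0r//; lia.
Qed.

Lemma hermite_squareS n : hermite_square n.+1 =
  hermite_square n + 'X * (n%:R *: hermite_square n - 2 *: ('X * (hermite_square n)^`())).
Proof.
apply/polyP => l; rewrite coefD coefXM; case: l => [|l].
  by rewrite !coef_hermite_square !bin0 addr0.
have coefXd (p : {poly R}) k : ('X * p^`())`_k = k%:R * p`_k.
  by rewrite coefXM coef_deriv; case: k => [|k]; rewrite ?mul0r// mulr_natl.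
rewrite coefB !coefZ coefXd !coef_hermite_square/= doubleS binS natrD.
have -> : odd_fact l.+1 = odd_fact l * l.*2.+1%:R by rewrite /odd_fact big_ord_recr.
have bE : 'C(n, l.*2.+1)%:R * l.*2.+1%:R = (n%:R - l.*2%:R) * 'C(n, l.*2)%:R :> R.
  have [ln|nl] := leqP l.*2 n; last by rewrite !bin_small ?mul0r ?mulr0//; lia.
  by rewrite -natrB// -!natrM mulnC mul_bin_left.
have -> : 2 * (l%:R * ('C(n, l.*2)%:R * odd_fact l)) = l.*2%:R * 'C(n, l.*2)%:R * odd_fact l :> R.
  by rewrite -muln2 natrM; ring.
transitivity ('C(n, l.*2.+2)%:R * (odd_fact l * l.*2.+1%:R)
   + odd_fact l * ('C(n, l.*2.+1)%:R * l.*2.+1%:R)); first by ring.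
by rewrite bE; ring.
Qed.

Lemma axial_hermite_square n : axial (even_lift (hermite_square n)).
Proof.
elim: n => [|n IH].
  move=> z z0 /rootP; rewrite even_liftE.
  have -> : hermite_square 0 = 1.
    apply/polyP => l; rewrite coef_hermite_square coef1.
    by case: l => [|l]; rewrite ?bin0n ?mul0r// /odd_fact big_ord0 mulr1.
  by rewrite rmorph1 hornerC => /eqP; rewrite oner_eq0.
have sq : (size (even_lift (hermite_square n)) <= n.+1)%N.
  rewrite /even_lift size_map_poly; apply: leq_trans (size_comp_poly_leq _ _) _.
  rewrite size_polyXn /= ltnS.
  have : (size (hermite_square n) <= (n./2).+1)%N by apply: size_poly.
  move: (size _) => k kn; rewrite muln2 -geq_half_double.
  by case: k kn.
have := axial_reverse_step IH sq; congr axial.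
rewrite hermite_squareS -[in RHS]scaleN1r /=.
rewrite !(even_liftD, even_liftZ, even_liftXM) deriv_even_lift -!mul_polyC.
rewrite !rmorphN1 !rmorph_nat; move: (even_lift _) (even_lift _) => A B.
by ring.
Qed.

End Hermite.

(** * The cubes: even and odd parts of stable polynomials *)

Section HermiteBiehler.
Variable R : rcfType.

Lemma sqnM (z u : R[i]) : sqn (z * u) = sqn z * sqn u.
Proof. by case: z => a b; case: u => c d; rewrite /sqn /=; ring. Qed.

Lemma sqn_prod I (s : seq I) (F : I -> R[i]) :
  sqn (\prod_(i <- s) F i) = \prod_(i <- s) sqn (F i).
Proof. by apply: (big_morph _ sqnM); rewrite /sqn/= expr1n expr0n/= addr0. Qed.

Lemma sqnN (z : R[i]) : sqn (- z) = sqn z.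
Proof. by case: z => a b; rewrite /sqn/=; ring. Qed.

Lemma sqn_conj (z : R[i]) : sqn z^* = sqn z.
Proof. by case: z => a b; rewrite /sqn/=; ring. Qed.

Lemma horner_conj (G : {poly R}) (z : R[i]) :
  (map_poly (real_complex R) G).[z^*] = ((map_poly (real_complex R) G).[z])^*.
Proof.
have {1}-> : map_poly (real_complex R) G =
    map_poly (@conjc R) (map_poly (real_complex R) G).
  by apply/polyP => k; rewrite !coef_map/= oppr0.
by rewrite horner_map.
Qed.

Variable G : {poly R}.
Let GC := map_poly (real_complex R) G.
Hypothesis G_size : (1 < size G)%N.
Hypothesis G_stable : forall z, root GC z -> complex.Re z < 0.

Let G0 : GC != 0.
Proof. by rewrite map_poly_eq0 -size_poly_gt0 ltnW. Qed.

Let G_split : exists m (c : R[i]) (r : 'I_m.+1 -> R[i]),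
  [/\ c != 0, GC = c *: \prod_i ('X - (r i)%:P) & forall i, complex.Re (r i) < 0].
Proof.
have [[|m] [c [r [c0 Gr sG]]]] := poly_split G0.
  by move: G_size; rewrite -(size_map_poly (real_complex R)) -/GC sG.
exists m, c, r; split => // i; apply: G_stable.
by rewrite Gr -(mul_cofactor c r i) rootM root_XsubC eqxx.
Qed.

(** Each root lies closer to the reflection of z in the imaginary axis than
    to z, so |G| decreases when z is moved to its reflection. *)
Lemma stable_sqn_lt z : 0 < complex.Re z -> sqn GC.[- z] < sqn GC.[z].
Proof.
move=> z0; have [m [c [r [c0 Gr r0]]]] := G_split.
rewrite -sqn_conj -horner_conj -/GC Gr !hornerZ !horner_prod !sqnM !sqn_prod.
rewrite ltr_pM2l ?sqn_gt0//; apply: ltr_prod.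
  by apply/hasP; exists ord0; rewrite ?mem_index_enum.
move=> i _; rewrite sqn_ge0/= !hornerXsubC.
move: (r0 i); case: (r i) z0 => [a b]; case: z => [x y] /=; rewrite /sqn/= => x0 a0.
rewrite !opprK; have : x * a < 0 by rewrite pmulr_rlt0.
by move=> ?; lra.
Qed.

Lemma stable_log_deriv z : 0 <= complex.Re z ->
  exists2 S, GC^`().[z] = GC.[z] * S & 0 < complex.Re S.
Proof.
move=> z0; have [m [c [r [c0 Gr r0]]]] := G_split.
have zr i : z - r i != 0.
  by apply/eqP => /(congr1 (@complex.Re R)); rewrite ReB /=; have := r0 i; lra.
exists (\sum_i (1%:C / (z - r i))).
  rewrite {1}Gr deriv_sum_cofactors horner_sum mulr_sumr; apply: eq_bigr => i _.
  rewrite [in RHS]Gr -(mul_cofactor c r i) hornerM hornerXsubC; move: (zr i) => zri.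
  by rewrite rmorph1; field.
rewrite Re_sum (bigD1 ord0)//= ltr_pwDl//; last apply: sumr_ge0 => i _.
all: rewrite Re_div div1r ReB.
  by rewrite mulr_gt0 ?invr_gt0 ?sqn_gt0//; have := r0 ord0; lra.
by rewrite mulr_ge0 ?invr_ge0 ?sqn_ge0//; have := r0 i; lra.
Qed.

(** At a root |G(z)| = |G(-z)|, so [stable_sqn_lt] puts it on the imaginary axis.
    There -z is the conjugate of z, and with S = G'(z)/G(z) the derivative is
    G(z) (S + conj S), nonzero since Re S > 0. *)
Let axial_reflect (e : R[i]) : e ^+ 2 = 1 -> e^* = e -> axial (GC + e *: (GC \Po (- 'X))).
Proof.
move=> e2 ec z z0 /rootP.
have e_sqn : sqn e = 1.
  have := congr1 (@sqn R) e2; rewrite expr2 sqnM.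
  rewrite {3}/sqn/= expr1n expr0n/= addr0 => se2.
  by apply/eqP; rewrite -(@eqrXn2 _ 2) ?sqn_ge0// expr1n expr2 se2.
rewrite hornerD hornerZ horner_comp hornerN hornerX => Gz.
have sGz : sqn GC.[z] = sqn GC.[- z].
  by move/eqP: Gz; rewrite addr_eq0 => /eqP->; rewrite sqnN sqnM e_sqn mul1r.
have rez : complex.Re z = 0.
  have [zlt|zgt|//] := ltgtP (complex.Re z) 0.
    have /stable_sqn_lt : 0 < complex.Re (- z) by case: z zlt {z0 Gz sGz} => a b /=; lra.
    by rewrite opprK sGz ltxx.
  by have := stable_sqn_lt zgt; rewrite sGz ltxx.
split => //.
have Nz : - z = z^* by case: z rez {z0 Gz sGz} => a b /= ->; simpc; rewrite ?oppr0.
have Gz0 : GC.[z] != 0 by apply/negP => /eqP/rootP/G_stable; rewrite rez ltxx.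
have [S GS S0] : exists2 S, GC^`().[z] = GC.[z] * S & 0 < complex.Re S.
  by apply: stable_log_deriv; rewrite rez.
rewrite derivD derivZ deriv_comp derivN derivX mulrN1 hornerD hornerZ hornerN.
rewrite horner_comp hornerN hornerX.
have dGN : GC^`().[- z] = (GC^`().[z])^* by rewrite Nz /GC deriv_map horner_conj.
have GN : GC.[- z] = (GC.[z])^* by rewrite Nz /GC horner_conj.
rewrite dGN GS rmorphM/= -GN.
apply/negP => /eqP dz.
have : GC.[z] * (S + S^*) = 0.
  transitivity (GC.[z] * S + e * - (GC.[- z] * S^*) + (GC.[z] + e * GC.[- z]) * S^*); first by ring.
  by rewrite dz Gz mul0r addr0.
move/eqP; rewrite mulf_eq0 (negPf Gz0)/= => /eqP /(congr1 (@complex.Re R)).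
by rewrite ReD; case: S S0 {GS dz} => a b /=; lra.
Qed.

Let even_lift_comp q : even_lift q \Po (- 'X) = even_lift q :> {poly R[i]}.
Proof.
rewrite /even_lift map_comp_poly map_polyXn -comp_polyA.
by rewrite comp_Xn_poly sqrrN.
Qed.

Let GCE : GC = even_lift (even_poly G) + 'X * even_lift (odd_poly G).
Proof. by rewrite /GC -{1}(poly_even_odd G) rmorphD rmorphM/= map_polyX mulrC. Qed.

Let GCN : GC \Po (- 'X) = even_lift (even_poly G) - 'X * even_lift (odd_poly G).
Proof. by rewrite GCE comp_polyD comp_polyM comp_polyX !even_lift_comp mulNr. Qed.

Let half0 : (2 : R[i])^-1 != 0.
Proof. by rewrite invr_eq0 pnatr_eq0. Qed.

Lemma axial_even_part : axial (even_lift (even_poly G)).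
Proof.
have /(axialZ half0) := axial_reflect (expr1n _ 2) (conjc1 R).
rewrite scale1r GCN GCE; set E := even_lift _; set O := 'X * _.
by rewrite addrACA subrr addr0 -mulr2n -[E *+ 2]scaler_nat scalerA mulVf ?pnatr_eq0// scale1r.
Qed.

Lemma axial_odd_part : axial (even_lift (odd_poly G)).
Proof.
have e2 : (-1 : R[i]) ^+ 2 = 1 by rewrite sqrrN expr1n.
have ec : (-1 : R[i])^* = -1 by rewrite rmorphN rmorph1.
have /(axialZ half0) := axial_reflect e2 ec.
rewrite scaleN1r GCN GCE; set E := even_lift _; set O := even_lift _.
have -> : 2^-1 *: (E + 'X * O - (E - 'X * O)) = 'X * O.
  by rewrite opprB addrC subrKA -mulr2n -[('X * O) *+ 2]scaler_nat scalerA mulVf ?pnatr_eq0//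
    scale1r.
move=> ax z z0 Oz; have [|rez] := ax z z0; first by rewrite rootM Oz orbT.
rewrite derivM derivX mul1r hornerD hornerM hornerX (rootP Oz) add0r mulf_eq0 negb_or.
by case/andP.
Qed.

End HermiteBiehler.

Lemma coef_binomial (A : comNzRingType) (b : A) n k :
  ((1 + b *: 'X) ^+ n)`_k = 'C(n, k)%:R * b ^+ k.
Proof.
rewrite exprDn coef_sum.
under eq_bigr do rewrite expr1n mul1r coefMn exprZn coefZ coefXn.
have [kn|nk] := leqP k n; last first.
  rewrite bin_small// mul0r big1// => i _.
  by rewrite (gtn_eqF (leq_trans (ltn_ord i) nk))// mulr0 mul0rn.
rewrite (bigD1 (Ordinal (kn : (k < n.+1)%N)))//= eqxx mulr1 big1 ?addr0 ?mulr_natl//.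
move=> i ik; case: eqP => [ki|]; last by rewrite mulr0 mul0rn.
by case/eqP: ik; apply/val_inj.
Qed.

Section Binomials.
Variable R : rcfType.

Let G (b : R) n := (1 + b *: 'X) ^+ n : {poly R}.

Let size_G b n : 0 < b -> size (G b n) = n.+1.
Proof.
move=> b0; have s1 : size (1 + b *: 'X) = 2%N.
  by rewrite addrC size_polyDl ?size_polyC ?oner_eq0 size_scale ?size_polyX ?gt_eqF.
have G0 : G b n != 0 by rewrite expf_neq0// -size_poly_gt0 s1.
by rewrite -(prednK (n := size _)) ?size_poly_gt0// size_exp s1 mul1n.
Qed.

Let stable_G b n z : 0 < b -> root (map_poly (real_complex R) (G b n)) z -> complex.Re z < 0.
Proof.
move=> b0 /rootP/eqP; rewrite rmorphXn/= horner_exp expf_eq0 => /andP[_].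
rewrite rmorphD/= rmorph1 linearZ/= map_polyX !hornerE.
case: z => x y; rewrite eq_complex/= => /andP[/eqP h _].
by rewrite -(pmulr_rlt0 _ b0); lra.
Qed.

Lemma axial_binomial_even (b : R) n : (0 < n)%N -> 0 < b ->
  axial (even_lift (\poly_(l < (n./2).+1) ('C(n, l.*2)%:R * b ^+ l.*2))).
Proof.
move=> n0 b0.
have := @axial_even_part _ (G b n) _ (fun z => @stable_G b n z b0).
rewrite size_G// ltnS => /(_ n0).
rewrite (@even_polyE _ (n./2).+1) ?size_G//; last by lia.
congr (axial (even_lift _)); apply: eq_poly => l _; exact: coef_binomial.
Qed.

Lemma axial_binomial_odd (b : R) n : 0 < b ->
  axial (even_lift (\poly_(l < (n./2).+1) ('C(n.+1, l.*2.+1)%:R * b ^+ l.*2.+1))).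
Proof.
move=> b0.
have := @axial_odd_part _ (G b n.+1) _ (fun z => @stable_G b n.+1 z b0).
rewrite size_G// ltnS => /(_ isT).
rewrite (@odd_polyE _ (n./2).+1) ?size_G//; last by lia.
congr (axial (even_lift _)); apply: eq_poly => l _; exact: coef_binomial.
Qed.

End Binomials.

(** * Binomial sums weighted by averaged moments *)

Section MomentPolynomials.
Variable R : rcfType.
Variables (L : {linear {poly R} -> R^o}) (a : nat -> R) (n : nat).
Hypothesis L_pos : forall f : {poly R}, (forall u, 0 <= u < 1 -> 0 < f.[u]) -> 0 < L f.
Hypothesis a_moment : forall k, k.+1%:R * a k = L (\sum_(j < k.+1) 'X^j).

Let G : {poly R} := \poly_(k < n.+1) ('C(n, k)%:R * a k).

Let a_gt0 k : 0 < a k.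
Proof.
rewrite -(pmulr_rgt0 _ (ltr0Sn R k)) a_moment; apply: L_pos => u /andP[u0 u1].
rewrite horner_sum big_ord_recl hornerXn expr0 ltr_pwDl// sumr_ge0// => i _.
by rewrite hornerXn exprn_ge0.
Qed.

(** Since (k+1) C(n+1,k+1) = (n+1) C(n,k), multiplying (n+1) G(z) by
    z/(1+z)^(n+1) gives L applied to (1 - q^(n+1))/(1 - u), where
    q = (1 + z u)/(1 + z).  If Re z >= 0, z <> 0 and 0 <= u < 1, then |q| < 1 and
    this function of u has positive real part, so G(z) <> 0. *)
Let stable_G z : root (map_poly (real_complex R) G) z -> complex.Re z < 0.
Proof.
move=> /rootP Gz; rewrite ltNge; apply/negP => rez.
have z0 : z != 0.
  apply: contraTneq (a_gt0 0) => z0; move: Gz.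
  rewrite z0 horner_coef0 coef_map coef_poly/= bin0 mul1r => -[->].
  by rewrite ltxx.
have z1 : 1 + z != 0.
  by apply/eqP => /(congr1 (@complex.Re R)); rewrite ReD/=; lra.
pose w := z / (1 + z) ^+ n.+1.
(* rho(u) is the real part of (1 - q^(n+1))/(1 - u). *)
pose rho : {poly R} := \sum_(k < n.+1)
  complex.Re (w * ('C(n.+1, k.+1)%:R * z ^+ k)) *: \sum_(j < k.+1) 'X^j.
have Lrho : L rho = 0.
  rewrite linear_sum /=.
  transitivity (complex.Re (w * n.+1%:R * (map_poly (real_complex R) G).[z])); last first.
    by rewrite Gz mulr0.
  rewrite (@horner_coef_wide _ n.+1); last first.
    by rewrite size_map_poly size_poly.
  rewrite mulr_sumr Re_sum; apply: eq_bigr => k _.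
  rewrite linearZ/= -a_moment coef_map coef_poly ltn_ord.
  rewrite -[_ *: _]mulrC -ReZ; congr complex.Re.
  have rE : ('C(n, k)%:R * a k)%:C = 'C(n, k)%:R * (a k)%:C.
    by rewrite rmorphM rmorph_nat.
  rewrite [X in _ = _ * (X * _)]rE rmorphM rmorph_nat /=.
  transitivity (w * z ^+ k * (a k)%:C * (k.+1 * 'C(n.+1, k.+1))%:R).
    by rewrite natrM; ring.
  by rewrite -mul_bin_diag natrM; ring.
suff : 0 < L rho by rewrite Lrho ltxx.
apply: L_pos => u /andP[u0 u1].
have u1' : 0 < 1 - u by lra.
rewrite -(pmulr_rgt0 _ u1').
have -> : (1 - u) * rho.[u] = complex.Re (1 - ((1 + z * u%:C) / (1 + z)) ^+ n.+1).
  have binE (x : R[i]) : (1 + x) ^+ n.+1 = 1 + \sum_(k < n.+1) 'C(n.+1, k.+1)%:R * x ^+ k.+1.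
    rewrite exprDn big_ord_recl /= bin0 expr0 expr1n mul1r mulr1n; congr (_ + _).
    by apply: eq_bigr => k _; rewrite expr1n mul1r mulr_natl.
  have -> : 1 - ((1 + z * u%:C) / (1 + z)) ^+ n.+1 =
      ((1 + z) ^+ n.+1 - (1 + z * u%:C) ^+ n.+1) / (1 + z) ^+ n.+1.
    by rewrite expr_div_n mulrBl mulfV// expf_neq0.
  have -> : (1 + z) ^+ n.+1 - (1 + z * u%:C) ^+ n.+1 =
      \sum_(k < n.+1) 'C(n.+1, k.+1)%:R * z ^+ k.+1 * (1 - u ^+ k.+1)%:C.
    rewrite !binE opprD addrACA subrr add0r -sumrB; apply: eq_bigr => k _.
    by rewrite rmorphB rmorph1 rmorphXn/= exprMn mulrBr mulr1 mulrA.
  rewrite horner_sum mulr_sumr mulr_suml Re_sum.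
  apply: eq_bigr => k _; rewrite hornerZ horner_sum.
  under eq_bigr do rewrite hornerXn.
  have -> : 1 - u ^+ k.+1 = (1 - u) * \sum_(i < k.+1) u ^+ i.
    rewrite -{1}[1](expr1n _ k.+1) subrXX; congr (_ * _).
    by apply: eq_bigr => i _; rewrite expr1n mul1r.
  rewrite mulrCA [LHS]mulrC -ReZ; congr complex.Re.
  by rewrite /w [z ^+ k.+1]exprS; ring.
set q := _ / _.
have q1 : sqn q < 1.
  have s1 : 0 < sqn (1 + z) by apply: sqn_gt0.
  have : sqn (1 + z) * sqn q < sqn (1 + z).
    rewrite -sqnM /q mulrC divfK//.
    case: z rez z0 {Gz z1 w rho Lrho q s1} => x y /= x0; rewrite eq_complex/= negb_and => xy.
    rewrite /sqn/= !(mulr0, mul0r, add0r, subr0, addr0).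
    have : (0 < x) || (0 < y ^+ 2).
      rewrite exprn_even_gt0//= lt_neqAle x0 andbT eq_sym; exact: xy.
    have y2 : 0 <= y ^+ 2 by rewrite sqr_ge0.
    have xu : 0 <= x * u by rewrite mulr_ge0.
    have xu1 : 0 <= x * (1 - u) by rewrite mulr_ge0// ltW.
    have yu : (y * u) ^+ 2 <= y ^+ 2 * u.
      by rewrite exprMn ler_wpM2l// expr2 ler_piMr// ltW.
    case/orP => [xp|yp].
      have : 0 < x * (1 - u) by rewrite mulr_gt0.
      have yu1 : y ^+ 2 * u <= y ^+ 2 by rewrite ler_piMr// ltW.
      by nra.
    have : 0 < y ^+ 2 * (1 - u) by rewrite mulr_gt0.
    by nra.
  by rewrite -{2}[sqn (1 + z)]mulr1 ltr_pM2l.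
have qn : sqn (q ^+ n.+1) < 1.
  have -> : sqn (q ^+ n.+1) = sqn q ^+ n.+1.
    elim: n.+1 => [|m IH]; last by rewrite !exprS sqnM IH.
    by rewrite !expr0 /sqn/= expr1n expr0n/= addr0.
  by rewrite exprn_ilt1 ?sqn_ge0.
rewrite ReB/=; case: (q ^+ n.+1) qn => x y; rewrite /sqn/= => xy.
have := sqr_ge0 y; have : 0 <= (1 - x) ^+ 2 by apply: sqr_ge0.
by nra.
Qed.

Lemma axial_moment_even : (0 < n)%N ->
  axial (even_lift (\poly_(l < (n./2).+1) ('C(n, l.*2)%:R * a l.*2))).
Proof.
move=> n0.
have sG : size G = n.+1 by rewrite size_poly_eq// binn mul1r gt_eqF.
have := @axial_even_part _ G _ stable_G.
rewrite sG ltnS => /(_ n0).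
rewrite (@even_polyE _ (n./2).+1) ?sG//; last by lia.
congr (axial (even_lift _)); apply/polyP => l; rewrite !coef_poly.
case: ltnP => // ln; case: ltnP => //; lia.
Qed.

End MomentPolynomials.

(** * The squeezed ball for p = 4: sign changes *)

Section SignChanges.
Variable R : rcfType.

(** A negative root x of [q] gives the imaginary roots of z^2 = x, and z is a
    simple root of q(z^2) because the roots of [q] are distinct. *)
Lemma axial_negative_roots (q : {poly R}) (s : seq R) : q != 0 -> uniq s ->
  size q = (size s).+1 -> all (fun x => (x < 0) && root q x) s -> axial (even_lift q).
Proof.
move=> q0 us sq /allP sP z z0 /rootP; rewrite even_liftE => qz.
have qE : q = lead_coef q *: \prod_(x <- s) ('X - x%:P).
  apply: all_roots_prod_XsubC => //; last by rewrite uniq_rootsE.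
  by apply/allP => x /sP/andP[].
have [x xs zx] : exists2 x, x \in s & z ^+ 2 = x%:C.
  move/eqP: qz; rewrite {1}qE linearZ/= hornerZ mulf_eq0 fmorph_eq0 lead_coef_eq0 (negPf q0)/=.
  rewrite rmorph_prod/= horner_prod prodf_seq_eq0 => /hasP[x xs /=].
  by rewrite rmorphB/= map_polyX map_polyC/= hornerXsubC subr_eq0 => /eqP; exists x.
have /andP[x0 _] := sP x xs.
split.
  case: z z0 zx {qz} => a b _ /eqP; rewrite expr2 eq_complex/= => /andP[/eqP ab /eqP h].
  have /eqP : a * b = 0 by lra.
  rewrite mulf_eq0 => /orP[/eqP//|/eqP b0].
  by exfalso; have := sqr_ge0 a; rewrite b0 in ab; nra.
rewrite deriv_even_lift hornerZ hornerM hornerX even_liftE zx.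
rewrite !mulf_neq0 ?pnatr_eq0//.
have -> : (map_poly (real_complex R) q^`()).[x%:C] = (q^`().[x])%:C by rewrite horner_map.
rewrite fmorph_eq0 qE derivZ hornerZ mulf_neq0 ?lead_coef_eq0//.
rewrite deriv_prod// horner_sum (bigD1_seq x)//= [X in _ + X]big1_seq ?addr0; last first.
  move=> y /andP[yx ys]; rewrite /= derivXsubC mul1r horner_prod.
  apply/eqP; rewrite prodf_seq_eq0; apply/hasP; exists x => //=.
  by rewrite eq_sym yx hornerXsubC subrr eqxx.
rewrite /= derivXsubC mul1r horner_prod prodf_seq_neq0; apply/allP => y ys.
by apply/implyP => yx; rewrite hornerXsubC subr_eq0 eq_sym.
Qed.

(** There are m points for m roots: the last change of sign happens between
    - s (m-1) and minus infinity, where the leading coefficient decides. *)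
Lemma axial_sign_changes (q : {poly R}) m (s : nat -> R) :
  size q = m.+1 -> 0 < lead_coef q -> (forall j, 0 <= s j) ->
  (forall j k, (j < k < m)%N -> s j < s k) ->
  (forall j, (j < m)%N -> 0 < (-1) ^+ j * q.[- s j]) ->
  axial (even_lift q).
Proof.
move=> sq lq s0 s_mono s_sign.
have q0 : q != 0 by rewrite -size_poly_gt0 sq.
have lNq : lead_coef ((-1) ^+ m *: (q \Po (- 'X))) = lead_coef q.
  rewrite lead_coefZ lead_coef_comp ?size_polyN ?size_polyX// lead_coefN lead_coefX.
  by rewrite sq/= mulrCA -exprMn mulrNN mulr1 expr1n mulr1.
(* - M is a point to the left of all the - s j with the sign of q at minus infinity. *)
have [M sM qM] : exists2 M, forall j, (j < m)%N -> s j < M & 0 < (-1) ^+ m * q.[- M].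
  have [|M MP] := @poly_pinfty_gt_lc _ ((-1) ^+ m *: (q \Po (- 'X))); first by rewrite lNq.
  pose N := Num.max M (1 + \sum_(j < m) s j); exists N.
    move=> j jm; rewrite lt_max; apply/orP; right.
    rewrite (bigD1 (Ordinal jm))//= addrCA ltrDl ltr_pwDl//.
    by apply: sumr_ge0.
  have /MP : M <= N by rewrite le_max lexx.
  by rewrite lNq hornerZ horner_comp hornerN hornerX; apply: lt_le_trans.
pose s' j := if (j < m)%N then s j else M.
have s'_mono j k : (j < k <= m)%N -> s' j < s' k.
  move=> /andP[jk km]; rewrite /s' (leq_trans jk km); case: ltnP => km'.
    by apply: s_mono; rewrite jk.
  by apply: sM; rewrite (leq_trans jk km).
have s'_sign j : (j <= m)%N -> 0 < (-1) ^+ j * q.[- s' j].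
  rewrite leq_eqVlt /s' => /orP[/eqP->|jm]; first by rewrite ltnn.
  by rewrite jm s_sign.
have /fin_all_exists[r rP] (j : 'I_m) : exists x, (- s' j.+1 < x < - s' j) && root q x.
  have jm := ltn_ord j.
  have s1 := s'_sign j (ltnW jm); have s2 := s'_sign j.+1 jm.
  have s12 : s' j < s' j.+1 by apply: s'_mono; rewrite ltnSn.
  have [||x /andP[x1 x2]] := @poly_ivt _ ((-1) ^+ j *: q) (- s' j.+1) (- s' j).
  - by rewrite lerN2 ltW.
  - rewrite !hornerZ (ltW s1) andbT; move: s2; rewrite exprS mulN1r mulNr oppr_gt0.
    exact: ltW.
  rewrite rootZ ?signr_eq0// => rx; exists x; rewrite rx andbT !lt_neqAle x1 x2 !andbT.
  apply/andP; split; apply/eqP => xE.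
    by move: s2; rewrite xE (rootP rx) mulr0 ltxx.
  by move: s1; rewrite -xE (rootP rx) mulr0 ltxx.
have r_anti (j k : 'I_m) : (j < k)%N -> r k < r j.
  move=> jk; have /andP[/andP[r1 _] _] := rP j; have /andP[/andP[_ r2] _] := rP k.
  apply: lt_le_trans r2 _; apply: le_trans (ltW r1).
  rewrite lerN2; have [->//|jk'] := eqVneq j.+1 k.
  by apply/ltW/s'_mono; rewrite ltn_neqAle jk' jk ltnW.
apply: (@axial_negative_roots q [seq r j | j <- enum 'I_m]) => //.
- rewrite map_inj_uniq ?enum_uniq// => j k rjk; apply/val_inj/eqP.
  by case: ltngtP => // /r_anti; rewrite rjk ltxx.
- by rewrite size_map size_enum_ord.
apply/allP => _ /mapP[j _ ->]; have /andP[/andP[_ r2] ->] := rP j.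
by rewrite andbT (lt_le_trans r2)// oppr_le0 /s' ltn_ord.
Qed.

End SignChanges.

Lemma Re_horner_imaginary (R : rcfType) (G : {poly R}) (t : R) :
  complex.Re (map_poly (real_complex R) G).[t *i] = (even_poly G).[- t ^+ 2].
Proof.
rewrite -{1}(poly_even_odd G) rmorphD rmorphM/= map_polyX hornerD hornerM hornerX.
have t2 : (t *i) ^+ 2 = (- t ^+ 2)%:C by rewrite expr2; simpc.
rewrite -!/(even_lift _) !even_liftE t2 ReD !horner_map/=.
by rewrite !(mulr0, mul0r, subr0, addr0).
Qed.

Section Kernel4.
Variables (R : rcfType) (n : nat).

Definition kernel4 : {poly R} :=
  \poly_(l < (n./2).+1) ('C(n, l.*2)%:R * (2 / (l.+1 * l.+2)%:R)).

Let N k : R := (n + k)%:R.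

(** Up to a constant, C(n,k)/((k+2)(k+4)) is a combination of C(n+2,k+2),
    C(n+3,k+3) and C(n+4,k+4).  This writes x^4 [kernel4](x^2) as the even part of
    a combination of three binomial powers; the last two terms cancel what these
    powers contribute to it below x^4. *)
Let E : {poly R} := (8 * N 3 * N 4) *: ('X^2 * (1 + 'X) ^+ n.+2)
  - (24 * N 4) *: ('X * (1 + 'X) ^+ n.+3)
  + 24 *: (1 + 'X) ^+ n.+4 + (4 * N 3 * N 4) *: 'X^2 - 24%:P.

Let even_E : even_poly E = (N 1 * N 2 * N 3 * N 4) *: ('X^2 * kernel4).
Proof.
have cb m k : ((1 + 'X : {poly R}) ^+ m)`_k = 'C(m, k)%:R.
  by rewrite -['X]scale1r coef_binomial expr1n mulr1.
apply/polyP => l; rewrite coef_even_poly coefZ coefXnM.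
rewrite !(coefB, coefD, coefN, coefZ) coefXnM coefXM coefXn coefC !cb.
case: l => [|[|l]] /=.
- by rewrite bin0; ring.
- have c2 : 'C(n.+4, 2)%:R = N 4 * N 3 / 2 :> R.
    have : 2 * 'C(n.+4, 2)%:R = N 4 * N 3 :> R.
      by rewrite -!natrM -(mul_bin_diag n.+4 1) bin1 !addnS addn0.
    by move=> <-; field.
  rewrite bin0 bin1 c2 -[n.+3]addn3 -/(N 3); by field.
have binS_diag m k : 'C(m.+1, k.+1)%:R = m.+1%:R / k.+1%:R * 'C(m, k)%:R :> R.
  have : k.+1%:R * 'C(m.+1, k.+1)%:R = m.+1%:R * 'C(m, k)%:R :> R.
    by rewrite -!natrM -(mul_bin_diag m.+1 k).
  by move=> h; rewrite mulrAC -h [RHS]mulrC mulKf// pnatr_eq0.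
rewrite /= ?doubleS /= ?(subSS, subn0) coef_poly.
have -> : (if (l < n./2.+1)%N then 'C(n, l.*2)%:R * (2 / (l.+1 * l.+2)%:R) else 0)
   = 'C(n, l.*2)%:R * (2 / (l.+1 * l.+2)%:R) :> R.
  by case: ltnP => // nl; rewrite bin_small ?mul0r//; lia.
rewrite !binS_diag natrM /N !addnS addn0.
have -> : l.+1%:R = (l.*2%:R + 2) / 2 :> R by rewrite -muln2 natrM -natr1; field.
have -> : l.+2%:R = (l.*2%:R + 4) / 2 :> R by rewrite -muln2 natrM -!natr1; field.
have k0 : 0 <= l.*2%:R :> R by rewrite ler0n.
rewrite -!natr1; move: (l.*2%:R : R) ('C(_, _)%:R) (n%:R : R) k0 => k C m k0.
field.
by apply/and4P; split; rewrite gt_eqF//; lra.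
Qed.

(** With s/c = tan phi, [c +i* s] is e^(i phi) and 1 + i s/c = e^(i phi)/c.  The
    even part of [E] at - (s/c)^2 is the real part of [E] at i s/c, which becomes
    elementary when e^(i (n+2) phi) is real. *)
Lemma kernel4_eval (c s e : R) : c ^+ 2 + s ^+ 2 = 1 -> c != 0 ->
  (c +i* s) ^+ n.+2 = e%:C ->
  N 1 * N 2 * N 3 * N 4 * s ^+ 4 * c ^+ n * kernel4.[- (s / c) ^+ 2] =
  - e * (8 * (n%:R ^+ 2 + 4 * n%:R + 6) * s ^+ 2 - 24)
  - c ^+ n.+2 * (4 * N 3 * N 4 * s ^+ 2 + 24 * c ^+ 2).
Proof.
move=> cs c0 pe.
transitivity (c ^+ n.+4 * (even_poly E).[- (s / c) ^+ 2]).
  rewrite even_E hornerZ hornerM hornerXn; move: (kernel4.[_]) => K.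
  by rewrite !exprS; field.
rewrite -Re_horner_imaginary -ReZ.
have cC : c%:C != 0 by rewrite fmorph_eq0.
have z1 : 1 + (s / c) *i = (c +i* s) / c%:C.
  apply: (mulIf cC); rewrite divfK// mulrDl mul1r; simpc.
  by rewrite divfK.
have z2 : (s / c) *i = s *i / c%:C.
  by apply: (mulIf cC); rewrite divfK//; simpc; rewrite divfK.
have eval : (c ^+ n.+4)%:C * (map_poly (real_complex R) E).[(s / c) *i] =
    8 * (N 3)%:C * (N 4)%:C * (s *i) ^+ 2 * e%:C
    - 24 * (N 4)%:C * (s *i) * e%:C * (c +i* s) + 24 * e%:C * (c +i* s) ^+ 2
    + (4 * (N 3)%:C * (N 4)%:C * (s *i) ^+ 2 - 24 * c%:C ^+ 2) * c%:C ^+ n.+2.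
  have m1 m : map_poly (real_complex R) ((1 + 'X) ^+ m) = (1 + 'X) ^+ m.
    by rewrite rmorphXn/= rmorphD/= rmorph1 map_polyX.
  have -> : map_poly (real_complex R) E = (8 * N 3 * N 4)%:C *: ('X^2 * (1 + 'X) ^+ n.+2)
      - (24 * N 4)%:C *: ('X * (1 + 'X) ^+ n.+3)
      + 24%:C *: (1 + 'X) ^+ n.+4 + (4 * N 3 * N 4)%:C *: 'X^2 - 24%:C%:P.
    rewrite /E rmorphB rmorphD rmorphD rmorphB /= !map_polyZ /= map_polyC/=.
    rewrite [map_poly _ ('X^2 * _)]rmorphM [map_poly _ ('X * _)]rmorphM /=.
    by rewrite !m1 map_polyX map_polyXn.
  have -> : (8 * N 3 * N 4)%:C = 8 * (N 3)%:C * (N 4)%:C by rewrite !rmorphM rmorph_nat.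
  have -> : (24 * N 4)%:C = 24 * (N 4)%:C by rewrite !rmorphM rmorph_nat.
  have -> : (4 * N 3 * N 4)%:C = 4 * (N 3)%:C * (N 4)%:C by rewrite !rmorphM rmorph_nat.
  rewrite !(horner_exp, hornerD, hornerN, hornerZ, hornerM, hornerX, hornerC).
  rewrite [(c ^+ n.+4)%:C]rmorphXn [24%:C]rmorph_nat /= z1 z2 !expr_div_n.
  have n3 : (c +i* s) ^+ n.+3 = e%:C * (c +i* s) by rewrite exprSr pe.
  have n4 : (c +i* s) ^+ n.+4 = e%:C * (c +i* s) ^+ 2 by rewrite 2!exprSr pe -mulrA -expr2.
  rewrite n3 n4 pe; move: (e%:C) (N 3)%:C (N 4)%:C (c +i* s) (s *i) cC => eC A B z w.
  move: (c%:C) => d d0; rewrite ![d ^+ n.+4]exprS ![d ^+ n.+3]exprS.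
  have : d ^+ n.+2 != 0 by rewrite expf_neq0.
  move: (d ^+ n.+2) => D D0.
  by field; rewrite ?d0 ?D0 ?d0.
rewrite eval.
have si2 : (s *i) ^+ 2 = (- s ^+ 2)%:C by rewrite expr2; simpc.
have -> : 8 * (N 3)%:C * (N 4)%:C * (s *i) ^+ 2 * e%:C
    - 24 * (N 4)%:C * (s *i) * e%:C * (c +i* s) + 24 * e%:C * (c +i* s) ^+ 2
    + (4 * (N 3)%:C * (N 4)%:C * (s *i) ^+ 2 - 24 * c%:C ^+ 2) * c%:C ^+ n.+2 =
   (8 * N 3 * N 4 * (- s ^+ 2) * e)%:C - (24 * N 4 * e)%:C * (s *i * (c +i* s))
   + (24 * e)%:C * ((c +i* s) * (c +i* s))
   + ((4 * N 3 * N 4 * (- s ^+ 2) - 24 * c ^+ 2) * c ^+ n.+2)%:C.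
  rewrite si2; move: (c ^+ n.+2) (rmorphXn (real_complex R) n.+2 c) => D /= <-.
  by rewrite !(rmorphB, rmorphM, rmorphN, rmorphXn, rmorph_nat)/=; ring.
simpc => /=.
have c2 : c ^+ 2 = 1 - s ^+ 2 by rewrite -cs addrK.
rewrite -[c * c]expr2 !c2 /N !natrD; ring.
Qed.

End Kernel4.

Section Trigonometry.
Variable R : realType.
Implicit Types x y : R.

Definition cis x : R[i] := cos x +i* sin x.

Lemma cisX x k : cis x ^+ k = cis (k%:R * x).
Proof.
elim: k => [|k IH]; first by rewrite expr0 mul0r /cis cos0 sin0.
rewrite exprS IH -natr1 mulrDl mul1r addrC /cis cosD sinD; simpc.
by congr (_ +i* _); ring.
Qed.

(** Concavity: if sin x were below the chord, the mean value theorem on both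
    sides of x would contradict the decrease of cos. *)
Lemma sin_ge_chord x : 0 <= x <= pi / 2 -> 2 / pi * x <= sin x.
Proof.
have pi0 := pi_gt0 R.
have pi2 : 2 / pi * (pi / 2) = 1 :> R by rewrite mulrA divfK ?gt_eqF// divff.
case/andP; rewrite le_eqVlt => /predU1P[<- _|x0]; first by rewrite mulr0 sin0.
rewrite le_eqVlt => /predU1P[->|x1].
  by rewrite sin_pihalf pi2.
have sinc (a b : R) : {within `[a, b], continuous (@sin R)}.
  by apply: continuous_subspaceT => z; apply: continuous_sin.
have [c1 c1x e1] := MVT x0 (fun z _ => is_derive_sin z) (sinc 0 x).
have [c2 c2x e2] := MVT x1 (fun z _ => is_derive_sin z) (sinc x (pi / 2)).
rewrite leNgt; apply/negP => sx.
have : cos c2 < cos c1.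
  move: c1x c2x; rewrite !in_itv/= => /andP[a b] /andP[c d].
  by rewrite ltr_cos ?in_itv/= ?(lt_trans b)//; apply/andP; split; lra.
rewrite sin0 !subr0 in e1; rewrite sin_pihalf in e2.
have : cos c1 * x < 2 / pi * x by rewrite -e1.
rewrite ltr_pM2r// => h1.
have : 2 / pi * (pi / 2 - x) < cos c2 * (pi / 2 - x).
  rewrite -e2 mulrBr pi2.
  by rewrite ltrD2l ltrN2.
rewrite ltr_pM2r ?subr_gt0// => h2 h3.
by have := lt_trans (lt_trans h1 h2) h3; rewrite ltxx.
Qed.

(** The points are phi = 0 and phi = k pi/(n+2) for 2 <= k <= n/2.  At the latter,
    [kernel4_eval] with e = (-1)^k gives the sign (-1)^(k+1): from sin phi >= 2k/(n+2),
    the term in e, multiplied by this sign, is positive for k >= 2; the one in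
    cos^(n+2) has the same sign for even k and is dominated for odd k >= 3. *)
Lemma axial_kernel4 n : axial (even_lift (kernel4 R n)).
Proof.
set m := n./2; have pi0 := pi_gt0 R.
have lastE : 0 < 'C(n, m.*2)%:R * (2 / (m.+1 * m.+2)%:R) :> R.
  by rewrite mulr_gt0// ltr0n bin_gt0 /m; lia.
have sq : size (kernel4 R n) = m.+1 by rewrite size_poly_eq// gt_eqF.
have lq : 0 < lead_coef (kernel4 R n).
  by rewrite /lead_coef sq /= coef_poly ltnSn.
(* k = j.+1: the angle pi/(n+2) is skipped. *)
pose phi j : R := if j == 0%N then 0 else j.+1%:R * pi / n.+2%:R.
have phi0 j : 0 <= phi j by rewrite /phi; case: eqP => // _; rewrite divr_ge0// mulr_ge0// pi_ge0.
have phi_lt j : (j < m)%N -> phi j < pi / 2.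
  rewrite /phi => jm; case: eqP => [_|_]; first by rewrite divr_gt0.
  rewrite ltr_pdivrMr// mulrAC ltr_pdivlMr// mulrAC [X in _ < X]mulrC ltr_pM2r// -natrM ltr_nat.
  by rewrite /m in jm; lia.
have phi_mono j k : (j < k)%N -> phi j < phi k.
  case: k => // k; case: j => [|j] jk; rewrite /phi/=.
    by rewrite divr_gt0// mulr_gt0.
  by rewrite ltr_pM2r ?invr_gt0// ltr_pM2r// ltr_nat.
have phi_itv j : (j < m)%N -> phi j \in `](- (pi / 2)), (pi / 2)[.
  by move=> jm; rewrite in_itv/= phi_lt// andbT (lt_le_trans _ (phi0 j))// oppr_lt0 divr_gt0.
apply: (axial_sign_changes sq lq (s := fun j => tan (phi j) ^+ 2)).
- by move=> j; rewrite sqr_ge0.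
- move=> j k /andP[jk km]; have jm := ltn_trans jk km.
  have t0 : 0 <= tan (phi j).
    by rewrite -tan0 leNgt ltr_tan ?phi_itv// -?leNgt// in_itv/= oppr_lt0 divr_gt0.
  have tt : tan (phi j) < tan (phi k) by rewrite ltr_tan ?phi_itv// phi_mono.
  by rewrite ltrXn2r//.
case=> [|j] jm.
  rewrite expr0 mul1r /phi eqxx tan0 expr0n oppr0 horner_coef0 coef_poly /=.
  by rewrite double0 bin0 mul1r divr_gt0.
set x := phi j.+1; set k := j.+2.
have xE : n.+2%:R * x = k%:R * pi by rewrite /x /phi/= mulrC divfK ?pnatr_eq0.
have c0 : 0 < cos x.
  by apply: cos_gt0_pihalf; have := phi_itv _ jm; rewrite in_itv.
have pe : cis x ^+ n.+2 = ((-1) ^+ k)%:C.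
  rewrite cisX xE -cisX /cis cospi sinpi rmorphXn rmorphN rmorph1.
  by congr (_ ^+ _); apply/eqP; rewrite eq_complex/= oppr0 !eqxx.
have ev := kernel4_eval (cos2Dsin2 x) (lt0r_neq0 c0) pe.
set S := sin x in ev *.
have kn : (k <= m)%N by [].
have x01 : 0 <= x <= pi / 2 by rewrite phi0 ltW// phi_lt.
have Sge : k.*2%:R / n.+2%:R <= S.
  apply: le_trans (sin_ge_chord x01).
  have fE (K N p : R) : p != 0 -> N != 0 -> 2 / p * (K * p / N) = K * 2 / N.
    by move=> p1 N0; field; rewrite p1 N0.
  by rewrite /x /phi/= fE ?gt_eqF// -muln2 natrM.
have S2 : k.*2%:R ^+ 2 <= S ^+ 2 * n.+2%:R ^+ 2.
  rewrite -exprMn ler_sqr ?nnegrE ?ler0n ?mulr_ge0 ?ler0n//; last first.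
    by apply: le_trans Sge; rewrite divr_ge0.
  by rewrite -ler_pdivrMr.
have S0 : 0 < S by apply: lt_le_trans Sge; rewrite divr_gt0.
have cn0 : 0 <= cos x ^+ n.+2 by rewrite exprn_ge0// ltW.
have cn1 : cos x ^+ n.+2 <= 1 by rewrite exprn_ile1 ?cos_le1 ?(ltW c0).
have tE : tan x ^+ 2 = (S / cos x) ^+ 2 by [].
rewrite tE.
set N1 := (n + 1)%:R in ev; set N2 := (n + 2)%:R in ev.
set N3 := (n + 3)%:R in ev; set N4 := (n + 4)%:R in ev.
have Npos : 0 < N1 * N2 * N3 * N4 * S ^+ 4 * cos x ^+ n.
  by rewrite !mulr_gt0// ?exprn_gt0// ltr0n addnS.
rewrite -(pmulr_rgt0 _ Npos) mulrCA ev.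
have -> : cos x ^+ 2 = 1 - S ^+ 2 by rewrite /S -(cos2Dsin2 x) addrK.
set D := cos x ^+ n.+2 in cn0 cn1 *.
have -> : (-1) ^+ j.+1 * (- (-1) ^+ k * (8 * (n%:R ^+ 2 + 4 * n%:R + 6) * S ^+ 2 - 24)
   - D * (4 * N3 * N4 * S ^+ 2 + 24 * (1 - S ^+ 2))) =
   8 * (n%:R ^+ 2 + 4 * n%:R + 6) * S ^+ 2 - 24 -
   (-1) ^+ j.+1 * (D * (4 * N3 * N4 * S ^+ 2 + 24 * (1 - S ^+ 2))).
  by rewrite /k (exprS _ j.+1) mulN1r opprK mulrBr mulrA -expr2 sqrr_sign mul1r.
have N34 : 0 <= 4 * N3 * N4 * S ^+ 2 + 24 * (1 - S ^+ 2).
  have S1 : 0 <= 1 - S ^+ 2 by rewrite subr_ge0 /S -(cos2Dsin2 x) lerDr sqr_ge0.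
  have N34 : 0 <= 4 * N3 * N4 by rewrite -!natrM ler0n.
  by rewrite addr_ge0// mulr_ge0// sqr_ge0.
have n0 : 0 <= n%:R :> R by rewrite ler0n.
have n2E : n.+2%:R = n%:R + 2 :> R by rewrite -addn2 natrD.
rewrite {}n2E in S2.
have [jo|je] := boolP (odd j.+1).
  rewrite -signr_odd jo expr1 mulN1r opprK; apply: ltr_pwDl; last exact: mulr_ge0.
  have : 4 ^+ 2 <= k.*2%:R ^+ 2 :> R by rewrite ler_sqr ?nnegrE ?ler_nat.
  by move: (k.*2%:R ^+ 2 : R) (S ^+ 2) S2 (sqr_ge0 S) => K T; nra.
rewrite -signr_odd (negPf je) expr0 mul1r.
have k6 : 6 ^+ 2 <= k.*2%:R ^+ 2 :> R.
  rewrite ler_sqr ?nnegrE ?ler_nat// /k.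
  by case: j je {jm x xE c0 pe ev S kn x01 Sge S2 S0 cn0 cn1 tE Npos D N34 k} => [|j]//.
have N3E : N3 = n%:R + 3 by rewrite /N3 natrD.
have N4E : N4 = n%:R + 4 by rewrite /N4 natrD.
apply: (@lt_le_trans _ _ (8 * (n%:R ^+ 2 + 4 * n%:R + 6) * S ^+ 2 - 24 -
   (4 * N3 * N4 * S ^+ 2 + 24 * (1 - S ^+ 2)))); last first.
  by rewrite lerD2l lerN2 ler_piMl.
rewrite N3E N4E.
move: (k.*2%:R ^+ 2 : R) (S ^+ 2) (n%:R : R) S2 (sqr_ge0 S) n0 k6 => K T r; nra.
Qed.

End Trigonometry.

(** * The squeezed ball for p = 1 and p = 2: moments *)

Section SegmentIntegrals.
Variable R : realType.
Local Notation mu := (@lebesgue_measure R).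
Implicit Types (a b : R) (h F : R -> R).

Lemma integrable_segment h a b : {within `[a, b], continuous h} ->
  mu.-integrable `[a, b] (EFin \o h).
Proof. by move=> ch; apply: continuous_compact_integrable => //; apply: segment_compact. Qed.

Lemma segment_FTC h F a b : a < b -> {within `[a, b], continuous h} ->
  {within `[a, b], continuous F} ->
  (forall x, a < x < b -> is_derive x 1 F (h x)) ->
  \int[mu]_(x in `[a, b]) h x = F b - F a.
Proof.
move=> ab ch cF dF.
have [_ Fa Fb] := (continuous_within_itvP F ab).1 cF.
rewrite /Rintegral (@continuous_FTC2 _ h F)//; last first.
  move=> x; rewrite in_itv/= => xab; rewrite derive1E.
  by have dx := dF x xab; rewrite derive_val.
by split=> // x; rewrite in_itv/= => /dF [].
Qed.

Lemma Rintegral_segment_gt0 h a b : a < b -> {within `[a, b], continuous h} ->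
  (forall x, a < x < b -> 0 < h x) -> 0 < \int[mu]_(x in `[a, b]) h x.
Proof.
move=> ab ch h0; have ih := integrable_segment ch.
pose F x := \int[mu]_(t in `[a, x]) h t.
have cF : {within `[a, b], continuous F}.
  by apply: parameterized_integral_continuous => //; apply: ltW.
have [chi _ _] := (continuous_within_itvP h ab).1 ch.
have dF x : x \in `]a, b[ -> is_derive x 1 F (h x).
  move=> xab; have [ax xb] : a < x /\ x < b by move: xab; rewrite in_itv => /andP.
  have [dFx FE] := @continuous_FTC1_closed _ h a x b xb ih ax (chi x xab).
  by apply: DeriveDef; [exact: dFx|rewrite -derive1E; exact: FE].
have [c cab] := MVT ab dF cF.
rewrite /F set_itv1 Rintegral_set1 subr0 => ->.
by rewrite mulr_gt0 ?subr_gt0// h0//; move: cab; rewrite in_itv.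
Qed.

Lemma Rintegral_deriv_poly (p : {poly R}) a b : a < b ->
  \int[mu]_(x in `[a, b]) p^`().[x] = p.[b] - p.[a].
Proof.
move=> ab; apply: segment_FTC ab _ _ (fun x _ => is_derive_poly p x);
  by apply: continuous_subspaceT => x; apply: continuous_horner.
Qed.

End SegmentIntegrals.

Section MomentFunctionals.
Variable R : realType.
Local Notation mu := (@lebesgue_measure R).
Variables (a b : R) (g phi : R -> R).
Hypotheses (cg : {within `[a, b], continuous g}) (cphi : continuous phi).

Let L (f : {poly R}) : R^o := \int[mu]_(x in `[a, b]) (g x * f.[phi x]).

Let continuous_integrand f : {within `[a, b], continuous (fun x => g x * f.[phi x])}.
Proof.
move=> x; apply: cvgM; first exact: cg.
move: x; apply: continuous_subspaceT => y.
by apply: (@continuous_comp _ _ _ phi (horner f)); [apply: cphi|apply: continuous_horner].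
Qed.

Lemma integral_functional : exists M : {linear {poly R} -> R^o},
  forall f, M f = \int[mu]_(x in `[a, b]) (g x * f.[phi x]).
Proof.
have L_lin : linear L.
  move=> k p q; rewrite /L.
  under eq_Rintegral do rewrite hornerD hornerZ mulrDr mulrCA.
  have ci r := integrable_segment (@continuous_integrand r).
  rewrite RintegralD//= ?RintegralZl//.
  have := ci (k *: p); congr (mu.-integrable _ _).
  by apply/funext => x /=; rewrite hornerZ mulrCA.
pose M : {linear {poly R} -> R^o} := HB.pack L (GRing.isLinear.Build _ _ _ _ L L_lin).
by exists M.
Qed.

Lemma moment_functional : a < b -> (forall x, a < x < b -> 0 < g x) ->
  (forall x, a < x < b -> 0 <= phi x < 1) ->
  exists2 M : {linear {poly R} -> R^o},
  (forall f, M f = \int[mu]_(x in `[a, b]) (g x * f.[phi x])) &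
  (forall f : {poly R}, (forall u, 0 <= u < 1 -> 0 < f.[u]) -> 0 < M f).
Proof.
move=> ab g0 phi01; have [M ME] := integral_functional.
exists M => // f f0; rewrite ME; apply: (@Rintegral_segment_gt0 R) => // x xab.
by rewrite mulr_gt0 ?g0 ?f0 ?phi01.
Qed.

End MomentFunctionals.

Section SineAndLinearMoments.
Variable R : realType.
Local Notation mu := (@lebesgue_measure R).

(** The weights 2/(k+2) are the averaged moments of the density 2 (1 - x) on
    [0,1], because (1 - x) (1 + x + ... + x^k) = 1 - x^(k+1). *)
Lemma axial_kernel2 n : (0 < n)%N ->
  axial (even_lift (\poly_(l < (n./2).+1) ('C(n, l.*2)%:R / l.+1%:R : R))).
Proof.
move=> n0; pose g (x : R) : R := 2 * (1 - x).
have cg : continuous g.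
  by move=> x; apply: cvgM; [exact: cvg_cst|apply: cvgB; [exact: cvg_cst|exact: cvg_id]].
have cid : continuous (@id R) by move=> x; apply: cvg_id.
have [||M ME M0] := moment_functional (continuous_subspaceT cg) cid ltr01.
- by move=> x /andP[_ x1]; rewrite /g mulr_gt0// subr_gt0.
- by move=> x /andP[x0 x1]; rewrite ltW.
pose a k : R := 2 / k.+2%:R.
have := @axial_moment_even R M a n M0.
have aM k : k.+1%:R * a k = M (\sum_(j < k.+1) 'X^j).
  rewrite ME.
  have -> : \int[mu]_(x in `[0, 1]) (g x * (\sum_(j < k.+1) 'X^j).[x]) =
      \int[mu]_(x in `[0, 1]) (2 * (1 - x ^+ k.+1)).
    apply: eq_Rintegral => x _; rewrite /g -mulrA; congr (_ * _).
    rewrite -[1 in RHS](expr1n _ k.+1) subrXX horner_sum; congr (_ * _).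
    by apply: eq_bigr => i _; rewrite hornerXn expr1n mul1r.
  pose P : {poly R} := 2 *: ('X - k.+2%:R^-1 *: 'X^(k.+2)).
  transitivity (P.[1] - P.[0]).
    have -> : k.+1%:R = k.+2%:R - 1 :> R by rewrite -[k.+2%:R]natr1 addrK.
    have : k.+2%:R != 0 :> R by rewrite pnatr_eq0.
    rewrite /P !(hornerZ, hornerD, hornerN, hornerX, hornerXn) expr1n expr0n/= /a.
    by move: (k.+2%:R : R) => K K0; field.
  rewrite -Rintegral_deriv_poly//; apply: eq_Rintegral => x _.
  rewrite /P derivZ derivB derivX derivZ derivXn -['X^_ *+ _]scaler_nat scalerA mulVf ?pnatr_eq0//.
  by rewrite scale1r !(hornerZ, hornerD, hornerN, hornerC, hornerXn).
move=> /(_ aM n0); congr (axial (even_lift _)); apply: eq_poly => l _.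
have dE : l.*2.+2%:R = 2 * l.+1%:R :> R by rewrite -doubleS -mul2n natrM.
by rewrite /a dE; congr (_ * _); rewrite invfM mulrA mulfV ?mul1r ?pnatr_eq0.
Qed.

Let pihalf_gt0 : 0 < pi / 2 :> R.
Proof. by rewrite divr_gt0// pi_gt0. Qed.

(** The Wallis integrals. *)
Let S m : R := \int[mu]_(x in `[0, pi / 2]) sin x ^+ m.

Let csinX m a b : {within `[a, b], continuous (fun x : R => sin x ^+ m)}.
Proof.
apply: continuous_subspaceT => z.
by apply: (@continuous_comp _ _ _ sin (fun y : R => y ^+ m));
  [apply: continuous_sin|apply: exprn_continuous].
Qed.

Let S1 : S 1 = 1.
Proof.
have cF : {within `[0, pi / 2], continuous (- @cos R)}.
  by apply: continuous_subspaceT => x; apply: cvgN; apply: continuous_cos.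
have dF x : 0 < x < pi / 2 -> is_derive x 1 (- @cos R) (sin x ^+ 1).
  by move=> _; have := is_deriveN (is_derive_cos x); rewrite opprK.
have := segment_FTC pihalf_gt0 (@csinX 1 _ _) cF dF.
by rewrite !fctE cos_pihalf cos0 oppr0 sub0r opprK.
Qed.

Let SS m : m.+2%:R * S m.+2 = m.+1%:R * S m.
Proof.
pose F : R -> R := - @cos R * (@sin R) ^+ m.+1.
have FE x : F x = - cos x * sin x ^+ m.+1 by rewrite /F !fctE.
have cF : {within `[0, pi / 2], continuous F}.
  apply: continuous_subspaceT => x; apply: cvgM; first by apply: cvgN; apply: continuous_cos.
  rewrite (_ : _ ^+ _ = (fun y : R => y ^+ m.+1) \o @sin R); last by apply/funext => y; rewrite fctE.
  by apply: continuous_comp; [apply: continuous_sin|apply: exprn_continuous].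
have ch : {within `[0, pi / 2], continuous (fun x : R =>
    m.+2%:R * sin x ^+ m.+2 - m.+1%:R * sin x ^+ m)}.
  move=> x; apply: cvgB; apply: cvgM; try exact: cvg_cst; exact: csinX.
have dF x : 0 < x < pi / 2 -> is_derive x 1 F (m.+2%:R * sin x ^+ m.+2 - m.+1%:R * sin x ^+ m).
  move=> _; have := is_deriveM (is_deriveN (is_derive_cos x)) (is_deriveX m.+1 (is_derive_sin x)).
  congr (is_derive _ _ _ _).
  rewrite !fctE /GRing.scale/= !exprS.
  transitivity ((m.+1%:R + 1) * (sin x * (sin x * sin x ^+ m)) -
    m.+1%:R * ((cos x ^+ 2 + sin x ^+ 2) * sin x ^+ m)).
    by ring.
  by rewrite cos2Dsin2 natr1 mul1r.
have := segment_FTC pihalf_gt0 ch cF dF.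
rewrite !FE cos_pihalf sin0 expr0n/= oppr0 mul0r mulr0 subr0.
have iS k := integrable_segment (@csinX k 0 (pi / 2)).
have iZ k (r : R) : mu.-integrable `[0, pi / 2] (EFin \o (fun x : R => r * sin x ^+ k)).
  apply: integrable_segment => x; apply: cvgM; [exact: cvg_cst|exact: csinX].
rewrite RintegralB// !RintegralZl// => /eqP; rewrite subr_eq0 => /eqP.
by [].
Qed.

(** The recursion makes [b l] the Wallis integral of sin^(2l+1).  It is an
    averaged moment of f |-> integral of f(sin x)/(1 + sin x): this functional
    sends 1 to 1 and u^(2l+1) + u^(2l+2) to the Wallis integral, and these
    contributions add up to 2l+1 times the integral by the same recursion. *)
Lemma axial_kernel1 n (b : nat -> R) : (0 < n)%N -> b 0%N = 1 ->
  (forall l, l.*2.+3%:R * b l.+1 = l.*2.+2%:R * b l) ->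
  axial (even_lift (\poly_(l < (n./2).+1) ('C(n, l.*2)%:R * b l))).
Proof.
move=> n0 b0 bS; pose g (x : R) : R := (1 + sin x)^-1.
have sin01 (x : R) : 0 < x < pi / 2 -> 0 < sin x < 1.
  move=> x01; apply/andP; split; first exact: sin_gt0_pihalf.
  have /andP[x0 x1] := x01; have pi0 := pi_gt0 R.
  apply: lt_le_trans (sin_le1 (pi / 2)).
  by rewrite ltr_sin// in_itv/=; apply/andP; split; lra.
have s1 (x : R) : x \in `[0, pi / 2] -> 1 + sin x != 0.
  move=> xab; rewrite gt_eqF// ltr_pwDl// sin_ge0_pi//.
  by move: xab; rewrite in_itv/= => /andP[x0 x1]; have pi0 := pi_gt0 R; lra.
have cg : {within `[0, pi / 2], continuous g}.
  apply: continuous_in_subspaceT => x; rewrite inE => xab.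
  apply: cvgV; first exact: s1.
  by apply: cvgD; [exact: cvg_cst|exact: continuous_sin].
have [||M ME M0] := moment_functional cg (@continuous_sin R) pihalf_gt0.
- by move=> x /sin01/andP[sx _]; rewrite /g invr_gt0 ltr_pwDl// ltW.
- by move=> x /sin01/andP[sx ->]; rewrite ltW.
pose a k : R := M (\sum_(j < k.+1) 'X^j) / k.+1%:R.
have aM k : k.+1%:R * a k = M (\sum_(j < k.+1) 'X^j).
  by rewrite mulrC divfK// pnatr_eq0.
have := @axial_moment_even R M a n M0 aM n0; congr (axial (even_lift _)).
suff ab : forall l, a l.*2 = b l by apply: eq_poly => l _; rewrite ab.
have M1 : M 1 = 1.
  rewrite ME; under eq_Rintegral do rewrite hornerC mulr1.
  pose F : R -> R := - @cos R * g.
  have cF : {within `[0, pi / 2], continuous F}.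
    move=> x; apply: cvgM; last exact: cg.
    by move: x; apply: continuous_subspaceT => x; apply: cvgN; apply: continuous_cos.
  have dF x : 0 < x < pi / 2 -> is_derive x 1 F (g x).
    move=> x01; have sx : 1 + sin x != 0.
      by apply: s1; move/andP: x01 => [x0 x1]; rewrite in_itv/= !ltW.
    have dg : is_derive x 1 (cst (1 : R) + @sin R) (cos x).
      by have := is_deriveD (is_derive_cst (1 : R) x 1) (is_derive_sin x); rewrite add0r.
    have := is_deriveM (is_deriveN (is_derive_cos x)) (@is_deriveV R (cst (1 : R) + @sin R) x _ _ sx dg).
    congr (is_derive _ _ _ _).
    rewrite !fctE /GRing.scale/= /g.
    transitivity ((cos x ^+ 2 + sin x ^+ 2 + sin x) / (1 + sin x) ^+ 2); first by field.
    by rewrite cos2Dsin2; field.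
  have FE x : F x = - cos x * g x by rewrite /F !fctE.
  have -> := segment_FTC pihalf_gt0 cg cF dF.
  by rewrite !FE /g cos_pihalf cos0 sin0 addr0 oppr0 mul0r sub0r invr1 mulr1 opprK.
have M2 l : M ('X^(l.*2.+1) + 'X^(l.*2.+2)) = S l.*2.+1.
  rewrite ME; apply: eq_Rintegral => x; rewrite inE/= => xab.
  rewrite hornerD !hornerXn.
  have -> : sin x ^+ l.*2.+1 + sin x ^+ l.*2.+2 = (1 + sin x) * sin x ^+ l.*2.+1.
    by rewrite [sin x ^+ l.*2.+2]exprS mulrDl mul1r.
  by rewrite mulKf// s1.
have MS l : M (\sum_(j < l.*2.+1) 'X^j) = l.*2.+1%:R * S l.*2.+1.
  elim: l => [|l IH]; first by rewrite big_ord1 expr0 M1 S1 mulr1.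
  rewrite doubleS big_ord_recr big_ord_recr /=.
  by rewrite -addrA linearD/= IH M2 SS -[X in _ + X]mul1r -mulrDl natr1.
have aS l : a l.*2 = S l.*2.+1 by rewrite /a MS mulrAC divff ?mul1r ?pnatr_eq0.
elim=> [|l IH]; rewrite aS; first by rewrite S1 b0.
have l3 : l.*2.+3%:R != 0 :> R by rewrite pnatr_eq0.
by apply: (mulfI l3); rewrite bS doubleS SS -aS IH.
Qed.

End SineAndLinearMoments.

(** * The Gamma function *)

Section GammaFunction.
Variable R : realType.
Local Notation mu := (@lebesgue_measure R).
Implicit Types (c r t x : R).

Let decay r t := expR (- (r * t)).

Let is_derive_decay r t : is_derive t 1 (decay r) (- r * decay r t).
Proof.
have h : is_derive t 1 (fun s => - (r * s)) (- r).
  have := is_deriveN (is_deriveZ r (is_derive_id t 1)).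
  by rewrite /GRing.scale/= mulr1.
by have := @is_derive1_comp R expR (fun s => - (r * s)) t _ _ (is_derive_expR _) h; rewrite mulrC.
Qed.

Let continuous_decay r : continuous (decay r).
Proof.
move=> t; apply: differentiable_continuous.
by apply/derivable1_diffP; case: (is_derive_decay r t).
Qed.

Let decay_cvg0 r : 0 < r -> decay r t @[t --> +oo] --> 0.
Proof.
move=> r0; have h : r * t @[t --> +oo] --> +oo.
  by apply: gt0_cvgMry => //; exact: cvg_id.
exact: (cvg_comp _ _ h (@cvgr_expR R)).
Qed.

Let gamma_integrand c t := t `^ c * expR (- t).

Let integrand_decay c : 0 < c ->
  exists2 C, 0 < C & forall t, 0 <= t -> gamma_integrand c t <= C * decay 2^-1 t.
Proof.
move=> c0; have [m cm] : exists m, c <= m.+1%:R.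
  by exists (Num.truncn c); rewrite ltW// truncnS_gt.
pose K : R := 2 ^+ m.+1 * m.+1`!%:R.
have K1 : 1 <= K.
  by rewrite -[1]mulr1 ler_pM// ?exprn_ege1 ?ler1n ?fact_gt0.
exists K; first exact: lt_le_trans K1.
move=> t t0; have eE : decay 2^-1 t * decay 2^-1 t = expR (- t).
  by rewrite /decay -expRD; congr expR; field.
rewrite /gamma_integrand -eE mulrA ler_pM2r ?expR_gt0//.
rewrite /decay expRN ler_pdivrMr ?expR_gt0//.
have e1 : 1 <= expR (2^-1 * t) by rewrite -expR0 ler_expR mulr_ge0.
have [t1|t1] := leP t 1.
  have tc1 : t `^ c <= 1 `^ c by rewrite ge0_ler_powR ?nnegrE// ltW.
  rewrite powR1 in tc1; apply: le_trans tc1 _.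
  by apply: (le_trans K1); rewrite ler_peMr// (le_trans _ K1).
apply: le_trans (_ : t ^+ m.+1 <= _).
  by rewrite -powR_mulrn// ler_powR// ltW.
have t20 : 0 <= 2^-1 * t by rewrite mulr_ge0.
have := @expR_ge1Dxn R (2^-1 * t) m t20.
have -> : t ^+ m.+1 = K * ((2^-1 * t) ^+ m.+1 / m.+1`!%:R).
  rewrite /K exprMn exprVn mulrCA; field.
  by rewrite expf_neq0 ?pnatr_eq0// -lt0n fact_gt0.
have K0 : 0 < K by apply: lt_le_trans K1.
by move=> h; rewrite ler_pM2l//; lra.
Qed.

Let decay1 t : decay 1 t = expR (- t). Proof. by rewrite /decay mul1r. Qed.

Let is_derive_integrand c t : 0 < t ->
  is_derive t 1 (gamma_integrand c)
    (c * gamma_integrand (c - 1) t - gamma_integrand c t).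
Proof.
move=> t0; have := is_deriveM (is_derive1_powR c t0) (is_derive_decay 1 t).
have -> : (powR (R := R) ^~ c) * decay 1 = gamma_integrand c.
  by apply/funext => s; rewrite fctE /gamma_integrand decay1.
by congr (is_derive _ _ _ _); rewrite /GRing.scale/= decay1 /gamma_integrand; ring.
Qed.

Let continuous_integrand c : 0 < c -> {within `[0, +oo[, continuous (gamma_integrand c)}.
Proof.
move=> c0; apply/continuous_within_itvcyP; split.
  move=> t; rewrite in_itv/= andbT => t0.
  by apply: differentiable_continuous; apply/derivable1_diffP; case: (is_derive_integrand c t0).
rewrite {2}/gamma_integrand powR0 ?gt_eqF// mul0r -[X in _ --> X](mul0r (expR (- 0))).
apply: cvgM; first exact: powR_cvg0.
apply: cvg_at_right_filter.
under eq_fun do rewrite -decay1; rewrite -decay1; exact: continuous_decay.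
Qed.

Let integrand_ge0 c t : 0 <= gamma_integrand c t.
Proof. by rewrite mulr_ge0 ?powR_ge0 ?expR_ge0. Qed.

Let integral_decay : (\int[mu]_(t in `[0%R, +oo[) (decay 2^-1 t)%:E = 2%:E)%E.
Proof.
pose F t : R := -2 * decay 2^-1 t.
have dF t : is_derive t 1 F (decay 2^-1 t).
  have := is_deriveZ (-2) (is_derive_decay 2^-1 t); rewrite /GRing.scale/=.
  by rewrite mulrA mulrNN mulfV ?mul1r.
have cF : continuous F.
  by move=> t; apply: differentiable_continuous; apply/derivable1_diffP; case: (dF t).
have -> : (2%:E = 0%:E - (F 0)%:E :> \bar R)%E.
  by rewrite /F /decay mulr0 oppr0 expR0 mulr1 -EFinB sub0r opprK.
apply: (@ge0_continuous_FTC2y R (decay 2^-1) F).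
- by move=> t _; apply: expR_ge0.
- by apply: continuous_subspaceT; apply: continuous_decay.
- rewrite -[X in _ --> X](mulr0 (-2)); apply: cvgM; first exact: cvg_cst.
  exact: decay_cvg0.
- by move=> t _; case: (dF t).
- by apply: cvg_at_right_filter; apply: cF.
- by move=> t _; rewrite derive1E; case: (dF t).
Qed.

Let integrable_decay : mu.-integrable `[0, +oo[ (EFin \o decay 2^-1).
Proof.
apply/integrableP; split.
  by apply/measurable_EFinP; apply: measurable_funTS; apply: continuous_measurable_fun.
under eq_integral do rewrite /= ger0_norm ?expR_ge0//.
by rewrite integral_decay ltry.
Qed.

Let integrable_integrand c : 0 < c -> mu.-integrable `[0, +oo[ (EFin \o gamma_integrand c).
Proof.
move=> c0; have [C C0 CP] := integrand_decay c0.
have mg : measurable_fun (`[0, +oo[%classic : set R) (gamma_integrand c).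
  by apply: subspace_continuous_measurable_fun => //; apply: continuous_integrand.
apply: (le_integrable _ _ _ (integrableZl _ C integrable_decay)) => //.
- exact/measurable_EFinP.
- move=> t; rewrite /= in_itv/= andbT => t0.
  rewrite lee_fin !ger0_norm ?CP ?integrand_ge0//.
  by rewrite mulr_ge0 ?expR_ge0// ltW.
Qed.

Let Gamma_integrand x : 1 < x -> Gamma x = \int[mu]_(t in `[0, +oo[) gamma_integrand (x - 1) t.
Proof.
move=> x1; rewrite /Gamma Rintegral_itv_obnd_cbnd//.
apply: integrableS (integrable_integrand (_ : 0 < x - 1)) => //; last by rewrite subr_gt0.
by move=> t; rewrite /= !in_itv/= !andbT => /ltW.
Qed.

(** Integration by parts.  For x > 1 both integrands extend continuously to
    t = 0.  The fundamental theorem on a half-line is applied to a nonnegative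
    function, so a large multiple of e^(-t/2), whose integral is known, is added
    to the derivative of - t^x e^(-t). *)
Lemma GammaS x : 1 < x -> Gamma (x + 1) = x * Gamma x.
Proof.
move=> x1; have x0 : 0 < x by apply: lt_trans x1.
have xB1 : 0 < x - 1 by rewrite subr_gt0.
rewrite !Gamma_integrand ?ltrDr// addrK.
have [C C0 CP] := integrand_decay xB1; have [D D0 DP] := integrand_decay x0.
pose f t := gamma_integrand x t - x * gamma_integrand (x - 1) t + x * C * decay 2^-1 t.
have cD r : {within `[0, +oo[, continuous (decay r)}.
  by apply: continuous_subspaceT; apply: continuous_decay.
have cf : {within `[0, +oo[, continuous f}.
  move=> t; apply: cvgD.
    apply: cvgB; first exact: continuous_integrand.
    by apply: cvgM; [exact: cvg_cst|exact: continuous_integrand].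
  by apply: cvgM; [exact: cvg_cst|exact: cD].
pose F t := - gamma_integrand x t + - 2 * (x * C) * decay 2^-1 t.
have dF t : 0 < t -> is_derive t 1 F (f t).
  move=> t0; have := is_deriveD (is_deriveN (is_derive_integrand x t0))
    (is_deriveZ (- 2 * (x * C)) (is_derive_decay 2^-1 t)).
  congr (is_derive _ _ _ _); by rewrite /f /GRing.scale/=; field.
have F0 : F 0 = - 2 * (x * C).
  by rewrite /F /gamma_integrand powR0 ?gt_eqF// mul0r oppr0 add0r /decay mulr0 oppr0 expR0 mulr1.
have intf : \int[mu]_(t in `[0, +oo[) f t = 2 * (x * C).
  rewrite (@Rintegral_ge0_continuous_FTC2y R f F 0 0).
  - by rewrite F0 sub0r mulNr opprK.
  - move=> t t0; rewrite /f -addrA addr_ge0 ?integrand_ge0//.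
    by rewrite addrC -mulrA -mulrBr mulr_ge0 ?(ltW x0)// subr_ge0 CP.
  - exact: cf.
  - rewrite -[X in _ --> X](addr0 0); apply: cvgD.
      rewrite -[X in _ --> X]oppr0; apply: cvgN.
      apply: (squeeze_cvgr (f := cst 0) (h := fun t => D * decay 2^-1 t)).
      + near=> t; by rewrite integrand_ge0/= DP//.
      + exact: cvg_cst.
      + rewrite -[X in _ --> X](mulr0 D); apply: cvgM; first exact: cvg_cst.
        exact: decay_cvg0.
    rewrite -[X in _ --> X](mulr0 (- 2 * (x * C))); apply: cvgM; first exact: cvg_cst.
    exact: decay_cvg0.
  - by move=> t t0; case: (dF t t0).
  - suff cF : {within `[0, +oo[, continuous F} by case: ((continuous_within_itvcyP 0 F).1 cF).
    move=> t; apply: cvgD; first by apply: cvgN; exact: continuous_integrand.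
    by apply: cvgM; [exact: cvg_cst|exact: cD].
  - by move=> t; rewrite in_itv/= andbT derive1E => t0; case: (dF t t0).
have iD : mu.-integrable `[0, +oo[ (EFin \o (fun t => x * C * decay 2^-1 t)).
  exact: (integrableZl _ (x * C) integrable_decay).
have ix := integrable_integrand x0; have iB := integrable_integrand xB1.
have ixB : mu.-integrable `[0, +oo[ (EFin \o (fun t => x * gamma_integrand (x - 1) t)).
  exact: (integrableZl _ x iB).
move: intf; rewrite /f RintegralD//; last exact: (integrableB _ ix ixB).
rewrite RintegralB// RintegralZl// RintegralZl// [\int[mu]_(x in _) decay _ _]/Rintegral integral_decay /=.
by move/eqP; rewrite [2 * _]mulrC -subr_eq0 addrK subr_eq0 => /eqP.
Unshelve. all: by end_near. Qed.

Lemma Gamma_gt0 x : 1 < x -> 0 < Gamma x.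
Proof.
move=> x1; have xB1 : 0 < x - 1 by rewrite subr_gt0.
rewrite Gamma_integrand//.
have sub : (`[1, 2]%classic : set R) `<=` `[0, +oo[%classic.
  by move=> t; rewrite /= !in_itv/= andbT => /andP[t1 _]; apply: le_trans t1.
have cg : {within `[1, 2], continuous (gamma_integrand (x - 1))}.
  exact: (continuous_subspaceW sub (continuous_integrand xB1)).
have : 0 < \int[mu]_(t in `[1, 2]) gamma_integrand (x - 1) t.
  apply: Rintegral_segment_gt0 => //; first by rewrite ltr1n.
  move=> t /andP[t1 _]; rewrite mulr_gt0 ?expR_gt0// powR_gt0//.
  exact: lt_trans t1.
move=> /lt_le_trans; apply; apply: fine_le.
- exact: (integrable_fin_num _ (integrable_segment cg)).
- exact: (integrable_fin_num _ (integrable_integrand xB1)).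
apply: ge0_subset_integral => //.
  by have /integrableP[] := integrable_integrand xB1.
by move=> t _; rewrite lee_fin integrand_ge0.
Qed.

End GammaFunction.

(** * Volumes by slicing *)

Section SphericalOperator.
Variable R : realType.
Local Notation mu := (@lebesgue_measure R).
Implicit Types (a b c d t s : R) (P : {poly R}).

(** The change of variables goes through an antiderivative [H] of [G] that
    starts to the left of the segments involved. *)
Lemma affine_substitution (G : R -> R) a b c d : continuous G -> a < b -> 0 < c ->
  \int[mu]_(x in `[a, b]) (c * G (c * x + d)) =
  \int[mu]_(x in `[c * a + d, c * b + d]) G x.
Proof.
move=> cG ab c0.
pose m := c * a + d - 1.
pose H x := \int[mu]_(t in `[m, x]) G t.
have iG x : mu.-integrable `[m, x] (EFin \o G).
  by apply: integrable_segment; apply: continuous_subspaceT.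
have dH x : m < x -> is_derive x 1 H (G x).
  move=> mx; have xx : x < x + 1 by rewrite ltrDl.
  have [dHx HE] := @continuous_FTC1_closed _ G m x (x + 1) xx (iG _) mx (cG x).
  by apply: DeriveDef; [exact: dHx|rewrite -derive1E; exact: HE].
have cH x y : m < x -> {within `[x, y], continuous H}.
  move=> mx; apply: continuous_in_subspaceT => z; rewrite inE/= in_itv/= => /andP[xz _].
  by apply: differentiable_continuous; apply/derivable1_diffP; case: (dH z (lt_le_trans mx xz)).
have ma : m < c * a + d by rewrite ltrBlDr ltr_pwDr.
have mid x : x \in `[a, b] -> m < c * x + d.
  rewrite in_itv/= => /andP[ax _].
  by apply: lt_le_trans ma _; rewrite lerD2r ler_pM2l.
have dphi (x : R) : is_derive x 1 (fun y => c * y + d) c.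
  have := is_deriveD (is_deriveZ c (is_derive_id x (1 : R))) (is_derive_cst d x (1 : R)).
  by rewrite /GRing.scale/= mulr1 addr0.
have dHphi x : x \in `[a, b] ->
    is_derive x 1 (H \o (fun y => c * y + d)) (c * G (c * x + d)).
  move=> xab.
  have := @is_derive1_comp R H (fun y => c * y + d) x _ _ (dH _ (mid x xab)) (dphi x).
  by rewrite mulrC.
have -> : \int[mu]_(x in `[a, b]) (c * G (c * x + d)) = H (c * b + d) - H (c * a + d).
  apply: (@segment_FTC R _ (H \o (fun y => c * y + d)) a b ab).
  - apply: continuous_subspaceT => x; apply: cvgM; first exact: cvg_cst.
    apply: (@continuous_comp _ _ _ (fun y => c * y + d) G); last exact: cG.
    by apply: cvgD; [apply: cvgM; [exact: cvg_cst|exact: cvg_id]|exact: cvg_cst].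
  - apply: continuous_in_subspaceT => x; rewrite inE => xab.
    by apply: differentiable_continuous; apply/derivable1_diffP; case: (dHphi x xab).
  - by move=> x /andP[ax xb]; apply: dHphi; rewrite in_itv/= !ltW.
symmetry; apply: segment_FTC => //.
- by rewrite ltrD2r ltr_pM2l.
- by apply: continuous_subspaceT.
- exact: cH.
- by move=> z /andP[az _]; apply: dH; apply: lt_trans az.
Qed.

(** Half the length of the chord of the disc of radius t at distance s from the
    centre. *)
Definition halfchord t s := Num.sqrt (t ^+ 2 - s ^+ 2).

Lemma continuous_halfchord t : continuous (halfchord t).
Proof.
move=> s; apply: (@continuous_comp _ _ _ (fun s => t ^+ 2 - s ^+ 2) Num.sqrt).
  by apply: cvgB; [exact: cvg_cst|exact: exprn_continuous].
exact: sqrt_continuous.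
Qed.

Lemma continuous_horner_halfchord P t : continuous (fun s => P.[halfchord t s]).
Proof.
move=> s; apply: (@continuous_comp _ _ _ (halfchord t) (horner P)); last exact: continuous_horner.
exact: continuous_halfchord.
Qed.
Definition kappa k : R := \int[mu]_(s in `[-1, 1]) halfchord 1 s ^+ k.

(** The operator J that sends t^k to kappa_k t^(k+1): the effect of one more
    squared coordinate on a volume that is polynomial in the radius, see
    [integral_halfchord]. *)
Definition spherical P : {poly R} := 'X * \poly_(k < size P) (P`_k * kappa k).

Lemma coef_spherical P k : (spherical P)`_k.+1 = P`_k * kappa k.
Proof.
rewrite /spherical coefXM /= coef_poly; case: ltnP => // Pk.
by rewrite nth_default// mul0r.
Qed.

Lemma integral_halfchord P t : 0 <= t ->
  \int[mu]_(s in `[- t, t]) P.[halfchord t s] = (spherical P).[t].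
Proof.
rewrite le_eqVlt => /predU1P[<-|t0].
  by rewrite oppr0 set_itv1 Rintegral_set1 /spherical hornerM hornerX mul0r.
have N11 : -1 < 1 :> R by lra.
have := affine_substitution 0 (@continuous_horner_halfchord P t) N11 t0.
rewrite mulrN1 mulr1 !addr0 => <-.
have cc : continuous (cst t : R -> R) by move=> x; apply: cvg_cst.
have [M ME] := integral_functional (a := -1) (b := 1) (continuous_subspaceT cc) (@continuous_halfchord 1).
transitivity (M (\sum_(k < size P) (P`_k * t ^+ k) *: 'X^k)).
  rewrite ME; apply: eq_Rintegral => s _; congr (_ * _).
  have -> : halfchord t (t * s + 0) = t * halfchord 1 s.
    rewrite /halfchord addr0 expr1n exprMn -[X in X - _]mulr1 -mulrBr sqrtrM ?sqr_ge0//.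
    by rewrite sqrtr_sqr gtr0_norm.
  rewrite horner_coef horner_sum; apply: eq_bigr => k _.
  by rewrite hornerZ hornerXn exprMn mulrA.
rewrite linear_sum/= /spherical hornerM hornerX horner_poly mulr_sumr.
apply: eq_bigr => k _; rewrite linearZ/= ME /kappa.
under eq_Rintegral do rewrite hornerXn.
rewrite RintegralZl//; last first.
  apply: integrable_segment; apply: continuous_subspaceT => s.
  apply: (@continuous_comp _ _ _ (halfchord 1) (fun y => y ^+ k)).
    exact: continuous_halfchord.
  exact: exprn_continuous.
by rewrite /GRing.scale/=; ring.
Qed.

End SphericalOperator.

Section Slicing.
Variable R : realType.
Local Notation mu := (@lebesgue_measure R).

Definition cons_row n (x : R) (y : 'rV[R]_n) : 'rV[R]_n.+1 :=
  \row_i (if unlift ord0 i is Some j then y 0 j else x).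

Lemma cons_row0 n x (y : 'rV[R]_n) : cons_row x y 0 ord0 = x.
Proof. by rewrite mxE unlift_none. Qed.

Lemma cons_rowS n x (y : 'rV[R]_n) i : cons_row x y 0 (lift ord0 i) = y 0 i.
Proof. by rewrite mxE liftK. Qed.

(** The measure is an iterated integral of sections by definition, so slicing
    holds for arbitrary sets. *)
Lemma volume_slices n (A : set 'rV[R]_n.+1) :
  volume A = (\int[mu]_x volume [set y | A (cons_row x y)])%E.
Proof.
rewrite /volume /= /pushforward /product_measure1; apply: eq_integral => x _ /=.
congr (lebesgue_tuple _); apply/seteqP; split => t /=.
  rewrite /xsection/= inE/=; congr (A _); apply/rowP => i.
  rewrite !mxE; case: unliftP => [j ->|->]; last by rewrite tnth0.
  by rewrite tnthS mxE.
rewrite /xsection/= inE/=; congr (A _); apply/rowP => i.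
rewrite !mxE; case: unliftP => [j ->|->]; last by rewrite tnth0.
by rewrite tnthS mxE.
Qed.

Lemma volume0 (A : set 'rV[R]_0) : volume A = (\1_A 0)%:E.
Proof.
rewrite /volume /= diracE indicE; congr ((nat_of_bool _)%:R%:E).
apply/idP/idP; rewrite !inE /=.
  by congr (A _); apply/rowP => -[].
by congr (A _); apply/rowP => -[].
Qed.

End Slicing.

Section SublevelVolumes.
Variable R : realType.
Local Notation mu := (@lebesgue_measure R).
Implicit Types (P : {poly R}) (g : nat -> R -> R) (r t : R).

Definition sublevel n g r : set 'rV[R]_n := [set x | \sum_(i < n) g i (x 0 i) <= r].

(** The volume of a sublevel set of nonnegative functions at level r, when it is
    polynomial in sqrt r: the set is empty for r < 0. *)
Definition truncated_value P r : R := if 0 <= r then P.[Num.sqrt r] else 0.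

Lemma sublevel_slice n g r x :
  [set y | sublevel g r (cons_row x y)] =
  sublevel (n := n) (fun i => g i.+1) (r - g 0%N x).
Proof.
rewrite /sublevel; apply/seteqP; split => y /=; rewrite big_ord_recl cons_row0 lerBrDl.
  by congr (_ + _ <= _); apply: eq_bigr => i _; rewrite cons_rowS.
by congr (_ + _ <= _); apply: eq_bigr => i _; rewrite cons_rowS.
Qed.

Lemma volume_sublevel0 g r : volume (sublevel (n := 0) g r) = (truncated_value 1 r)%:E.
Proof.
rewrite volume0 /truncated_value hornerC indicE /sublevel.
rewrite (_ : (_ \in _) = (0 <= r)); first by case: (0 <= r).
by apply/idP/idP; rewrite inE/= big_ord0.
Qed.

Lemma integral_segment_EFin (h : R -> R) a b : {within `[a, b], continuous h} ->
  (\int[mu]_(x in `[a, b]) (h x)%:E = (\int[mu]_(x in `[a, b]) h x)%:E)%E.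
Proof. by move=> ch; rewrite fineK// (integrable_fin_num _ (integrable_segment ch)). Qed.

Lemma split_segment (h : R -> R) a b c : continuous h -> a <= b -> b <= c ->
  \int[mu]_(x in `[a, c]) h x = \int[mu]_(x in `[a, b]) h x + \int[mu]_(x in `[b, c]) h x.
Proof.
move=> ch ab bc.
have ih x y : mu.-integrable `[x, y] (EFin \o h).
  by apply: integrable_segment; apply: continuous_subspaceT.
have := @Rintegral_itvB R h (BLeft a) (BRight c) b (ih a c) ab bc.
rewrite Rintegral_itv_obnd_cbnd; last first.
  by apply: integrableS (ih b c) => // x; rewrite /= !in_itv/= => /andP[/ltW-> ->].
by move=> <-; rewrite addrC subrK.
Qed.

Lemma integral_truncated_sqr P r :
  (\int[mu]_x (truncated_value P (r - x ^+ 2))%:E = (truncated_value (spherical P) r)%:E)%E.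
Proof.
rewrite /truncated_value; have [r0|r0] := leP 0 r; last first.
  by apply: integral0_eq => x _; rewrite leNgt subr_lt0 (lt_le_trans r0)// sqr_ge0.
pose t := Num.sqrt r; have t0 : 0 <= t by apply: sqrtr_ge0.
have tr : t ^+ 2 = r by rewrite sqr_sqrtr.
rewrite -integral_halfchord// -integral_segment_EFin; last first.
  by apply: continuous_subspaceT; apply: continuous_horner_halfchord.
rewrite [RHS]integral_mkcond; apply: eq_integral => x _; rewrite /patch.
have -> : (x \in `[- t, t]%classic) = (0 <= r - x ^+ 2).
  rewrite mem_setE in_itv/= -ler_norml subr_ge0 -tr -(real_normK (num_real x)).
  by rewrite ler_sqr ?nnegrE.
by case: ifP => // _; rewrite /halfchord tr.
Qed.

Lemma volume_sublevel_sqr n g P r : (forall x, g 0%N x = x ^+ 2) ->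
  (forall r, volume (sublevel (n := n) (fun i => g i.+1) r) = (truncated_value P r)%:E) ->
  volume (sublevel (n := n.+1) g r) = (truncated_value (spherical P) r)%:E.
Proof.
move=> g0 IH; rewrite volume_slices -integral_truncated_sqr; apply: eq_integral => x _.
by rewrite sublevel_slice IH g0.
Qed.

(** The squared distance from x to the segment [-b,b]. *)
Definition excess (b x : R) : R := Num.max 0 (`|x| - b) ^+ 2.

(** The segment [-1,1] contributes twice the value at t; the two pieces outside
    are the two halves of [-t,t], moved apart. *)
Lemma integral_truncated_excess P r :
  (\int[mu]_x (truncated_value P (r - excess 1 x))%:E =
   (truncated_value (2 *: P + spherical P) r)%:E)%E.
Proof.
rewrite /truncated_value; have [r0|r0] := leP 0 r; last first.
  by apply: integral0_eq => x _; rewrite leNgt subr_lt0 (lt_le_trans r0)// sqr_ge0.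
pose t := Num.sqrt r; have t0 : 0 <= t by apply: sqrtr_ge0.
have tr : t ^+ 2 = r by rewrite sqr_sqrtr.
pose h x := P.[Num.sqrt (r - excess 1 x)].
have ch : continuous h.
  move=> x; rewrite /h /excess.
  apply: (@continuous_comp _ _ _ (fun x => Num.sqrt (r - Num.max 0 (`|x| - 1) ^+ 2)) (horner P));
    last exact: continuous_horner.
  apply: (@continuous_comp _ _ _ (fun x => r - Num.max 0 (`|x| - 1) ^+ 2) Num.sqrt);
    last exact: sqrt_continuous.
  apply: cvgB; first exact: cvg_cst.
  have cm : continuous (fun x : R => Num.max 0 (`|x| - 1)).
    move=> y; apply: (@continuous_max _ _ (cst 0 : R -> R^o) (fun x : R => `|x| - 1)).
      exact: cvg_cst.
    by apply: cvgB; [exact: norm_continuous|exact: cvg_cst].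
  exact: (@continuous_comp _ _ _ _ (fun y : R => y ^+ 2) x (cm x) (@exprn_continuous _ 2 _)).
transitivity (\int[mu]_(x in `[(- (1 + t))%R, (1 + t)%R]) (h x)%:E)%E.
  rewrite [RHS]integral_mkcond; apply: eq_integral => x _; rewrite /patch.
  have -> : (x \in `[- (1 + t), 1 + t]%classic) = (0 <= r - excess 1 x).
    rewrite mem_setE in_itv/= -ler_norml subr_ge0 -tr.
    rewrite ler_sqr ?nnegrE ?le_max ?lexx// ge_max t0/=.
    by rewrite lerBlDl.
  by case: ifP.
rewrite integral_segment_EFin; last exact: continuous_subspaceT.
congr (_%:E).
have t1 : - (1 + t) <= -1 by lra.
have t2 : 1 <= 1 + t by lra.
rewrite (split_segment ch t1 (_ : -1 <= 1 + t)); last by lra.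
rewrite (split_segment ch (_ : -1 <= 1) t2); last by lra.
have -> : \int[mu]_(x in `[-1, 1]) h x = 2 * P.[t].
  transitivity (\int[mu]_(x in `[-1, 1]) (P.[t] *: 'X : {poly R})^`().[x]).
    apply: eq_Rintegral => x; rewrite inE/= in_itv/= -ler_norml => x1.
    rewrite derivZ derivX hornerZ hornerC mulr1 /h /excess max_l ?subr_le0//.
    by rewrite expr0n subr0.
  by rewrite Rintegral_deriv_poly ?hornerZ ?hornerX; [ring|lra].
rewrite hornerD hornerZ -integral_halfchord// addrCA; congr (_ + _).
rewrite (split_segment (@continuous_horner_halfchord R P t) (_ : - t <= 0) t0) ?oppr_le0//.
have shift a b d : a <= b -> \int[mu]_(x in `[a, b]) P.[halfchord t (x + d)] =
    \int[mu]_(x in `[a + d, b + d]) P.[halfchord t x].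
  rewrite le_eqVlt => /predU1P[->|ab]; first by rewrite !set_itv1 !Rintegral_set1.
  have := affine_substitution d (@continuous_horner_halfchord R P t) ab ltr01.
  rewrite !mul1r => <-.
  by apply: eq_Rintegral => x _; rewrite !mul1r.
congr (_ + _).
  transitivity (\int[mu]_(x in `[- (1 + t), -1]) P.[halfchord t (x + 1)]).
    apply: eq_Rintegral => x; rewrite inE/= in_itv/= => /andP[_ x1].
    rewrite /h /halfchord tr /excess ler0_norm; last by lra.
    by rewrite max_r; [congr P.[Num.sqrt (_ - _)]; ring|lra].
  have -> : - t = - (1 + t) + 1 by ring.
  by rewrite -[in RHS](addNr 1) shift.
transitivity (\int[mu]_(x in `[1, 1 + t]) P.[halfchord t (x + -1)]).
  apply: eq_Rintegral => x; rewrite inE/= in_itv/= => /andP[x1 _].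
  rewrite /h /halfchord tr /excess ger0_norm; last by lra.
  by rewrite max_r//; lra.
by rewrite shift// subrr addrAC subrr add0r.
Qed.

End SublevelVolumes.

(** * Parallel bodies of balls and boxes *)

Section ParallelBodies.
Variable R : realType.
Implicit Types (t : R).

Lemma sum_sqr_le0 n (w : 'I_n -> R) : \sum_i w i ^+ 2 <= 0 -> forall i, w i = 0.
Proof.
move=> w0 i; apply/eqP; rewrite -sqrf_eq0; apply/eqP.
apply: (psumr_eq0P (P := predT) (F := fun i => w i ^+ 2)) => // [j _|].
  exact: sqr_ge0.
by apply/eqP; rewrite eq_le w0 sumr_ge0// => j _; rewrite sqr_ge0.
Qed.

(** Minkowski's inequality in squared form, from the termwise bound
    (u + v)^2 <= (1 + b/a) u^2 + (1 + a/b) v^2. *)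
Lemma sum_sqr_add n (u v : 'I_n -> R) (a b : R) : 0 <= a -> 0 <= b ->
  \sum_i u i ^+ 2 <= a ^+ 2 -> \sum_i v i ^+ 2 <= b ^+ 2 ->
  \sum_i (u i + v i) ^+ 2 <= (a + b) ^+ 2.
Proof.
rewrite le_eqVlt => /predU1P[<- _|a0].
  by rewrite add0r expr0n/= => /sum_sqr_le0 u0 vb; under eq_bigr do rewrite u0 add0r.
rewrite le_eqVlt => /predU1P[<-|b0 ua vb].
  by rewrite addr0 expr0n/= => ua /sum_sqr_le0 v0; under eq_bigr do rewrite v0 addr0.
have : \sum_i (u i + v i) ^+ 2 <= \sum_i ((1 + b / a) * u i ^+ 2 + (1 + a / b) * v i ^+ 2).
  apply: ler_sum => i _.
  rewrite -subr_ge0.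
  have -> : (1 + b / a) * u i ^+ 2 + (1 + a / b) * v i ^+ 2 - (u i + v i) ^+ 2 =
     (b * u i - a * v i) ^+ 2 / (a * b).
    by field; rewrite !gt_eqF.
  by rewrite divr_ge0 ?sqr_ge0 ?mulr_ge0 ?ltW.
move=> /le_trans; apply; rewrite big_split/= -!mulr_sumr.
have -> : (a + b) ^+ 2 = (1 + b / a) * a ^+ 2 + (1 + a / b) * b ^+ 2.
  by field; rewrite !gt_eqF.
by rewrite lerD// ler_wpM2l// addr_ge0// divr_ge0 ?ltW.
Qed.

Lemma unit_ballE n (y : 'rV[R]_n) : unit_ball y = is_true (\sum_(i < n) y 0 i ^+ 2 <= 1).
Proof.
rewrite /unit_ball /=; congr (is_true (_ <= _)).
by apply: eq_bigr => i _; rewrite real_normK ?num_real.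
Qed.

(** Cubes and squeezed cubes are boxes with half-lengths 1 and 0. *)
Definition box n (b : nat -> R) : set 'rV[R]_n := [set x | forall i : 'I_n, `|x 0 i| <= b i].

Lemma excess0 (x : R) : excess 0 x = x ^+ 2.
Proof. by rewrite /excess subr0 max_r ?normr_ge0// real_normK ?num_real. Qed.

(** The nearest point of the box is found by clipping each coordinate. *)
Lemma parallel_box n (b : nat -> R) t : (forall i, 0 <= b i) -> 0 <= t ->
  parallel_body (@box n b) t = sublevel (fun i => excess (b i)) (t ^+ 2).
Proof.
move=> b0 t0; apply/seteqP; split => w /=.
  move=> [x xb [y y1 <-]]; rewrite /sublevel /=.
  apply: le_trans (_ : \sum_(i < n) t ^+ 2 * `|y 0 i| ^+ 2 <= _).
    apply: ler_sum => i _; rewrite !mxE -exprMn /excess ler_sqr ?nnegrE ?le_max ?lexx ?mulr_ge0//.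
    rewrite ge_max mulr_ge0//= lerBlDl.
    by apply: le_trans (ler_normD _ _) _; rewrite normrM (ger0_norm t0) lerD2r xb.
  by rewrite -mulr_sumr ler_piMr ?sqr_ge0.
move=> wt; pose clip (i : 'I_n) := Num.max (- b i) (Num.min (b i) (w 0 i)).
have clipP i : `|clip i| <= b i /\ (w 0 i - clip i) ^+ 2 = excess (b i) (w 0 i).
  have bi := b0 i; rewrite /clip /excess; move: (b i) (w 0 i) bi => B x B0.
  have [xB|xB] := leP B x.
    rewrite max_r; last lra.
    by rewrite !ger0_norm ?max_r; [split|lra|lra|lra].
  have [xN|xN] := leP x (- B).
    rewrite normrN ger0_norm// ler0_norm ?max_r; [|lra|lra].
    by split=> //; ring.
  rewrite max_l; last by rewrite subr_le0 ler_norml !ltW.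
  by rewrite subrr; split=> //; rewrite ler_norml !ltW.
exists (\row_i clip i); first by move=> i; rewrite mxE; case: (clipP i).
exists (\row_i ((w 0 i - clip i) / t)).
  rewrite unit_ballE.
  under eq_bigr => i _.
    rewrite mxE expr_div_n; case: (clipP i) => _ ->; over.
  rewrite -mulr_suml.
  have [->|tn0] := eqVneq t 0; first by rewrite expr0n invr0 mulr0.
  by rewrite ler_pdivrMr ?mul1r// exprn_gt0// lt_neqAle eq_sym tn0.
apply/rowP => i; rewrite !mxE.
have [tz|tn0] := eqVneq t 0; last by rewrite mulrC divfK// addrC subrK.
rewrite tz mul0r addr0; apply/esym/eqP; rewrite -subr_eq0 -sqrf_eq0.
have [_ ->] := clipP i.
apply/eqP; move: wt; rewrite /sublevel/= tz expr0n/= => /sum_sqr_le0 ez.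
by rewrite /excess ez expr0n.
Qed.

Lemma parallel_ball n t : 0 <= t ->
  parallel_body (@unit_ball R n) t = sublevel (fun _ x => x ^+ 2) ((1 + t) ^+ 2).
Proof.
move=> t0; have t1 : 0 < 1 + t by apply: ltr_pwDl.
apply/seteqP; split => w /=.
  move=> [x x1 [y y1 <-]]; rewrite /sublevel /=.
  under eq_bigr do rewrite !mxE.
  apply: sum_sqr_add => //.
    by rewrite expr1n -unit_ballE.
  under eq_bigr do rewrite exprMn.
  by rewrite -mulr_sumr ler_piMr ?sqr_ge0// -unit_ballE.
move=> wt; exists ((1 + t)^-1 *: w); last exists ((1 + t)^-1 *: w).
- rewrite unit_ballE; under eq_bigr do rewrite !mxE exprMn.
  by rewrite -mulr_sumr exprVn mulrC ler_pdivrMr ?exprn_gt0// mul1r.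
- rewrite unit_ballE; under eq_bigr do rewrite !mxE exprMn.
  by rewrite -mulr_sumr exprVn mulrC ler_pdivrMr ?exprn_gt0// mul1r.
- by rewrite -[X in X + _]scale1r -scalerDl scalerA mulfV ?scale1r// gt_eqF.
Qed.

Lemma unit_ball_split n (y : 'rV[R]_n.+1) : unit_ball y =
  is_true (\sum_(i < n) y 0 (lift ord_max i) ^+ 2 + y 0 ord_max ^+ 2 <= 1).
Proof.
rewrite unit_ballE big_ord_recr/=; congr (is_true (_ + _ <= _)).
apply: eq_bigr => i _; congr (y 0 _ ^+ 2).
by apply/val_inj; rewrite /= /bump leqNgt ltn_ord.
Qed.

(** The squared radius of the section at height z of the parallel body of the
    squeezed ball; -1 makes the sections with |z| > t empty. *)
Definition lens_radius t (z : R) : R := if `|z| <= t then (1 + halfchord t z) ^+ 2 else -1.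

(** A body of revolution about the last axis; r stands for the squares of
    coordinates already sliced off. *)
Definition revolved n (h : R -> R) (r : R) : set 'rV[R]_n.+1 :=
  [set x | \sum_(i < n) x 0 (lift ord_max i) ^+ 2 + r <= h (x 0 ord_max)].

(** At height z the section is a ball of radius 1 + sqrt(t^2 - z^2): the nearest
    point of the disc is obtained by shrinking the section radially. *)
Lemma parallel_squeezed_ball n t : 0 <= t ->
  parallel_body (squeezed (@unit_ball R n)) t = @revolved n (lens_radius t) 0.
Proof.
move=> t0; apply/seteqP; split => w; rewrite /revolved /= addr0.
  move=> [x [x1 xl] [y y1 <-]]; rewrite !mxE xl add0r.
  have yE : \sum_(i < n) y 0 (lift ord_max i) ^+ 2 + y 0 ord_max ^+ 2 <= 1.
    by move: y1; rewrite unit_ball_split.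
  have yl : `|t * y 0 ord_max| <= t.
    rewrite normrM (ger0_norm t0) ler_piMr// -(@expr_le1 _ 2)// real_normK ?num_real//.
    by apply: le_trans yE; rewrite lerDr sumr_ge0// => i _; rewrite sqr_ge0.
  rewrite /lens_radius yl; under eq_bigr do rewrite !mxE.
  apply: sum_sqr_add => //; first exact: sqrtr_ge0.
    rewrite expr1n; move: x1; rewrite unit_ballE.
    by under eq_bigr do rewrite mxE.
  under eq_bigr do rewrite exprMn.
  rewrite -mulr_sumr sqr_sqrtr; last first.
    by rewrite subr_ge0 -(real_normK (num_real (_ * _))) ler_sqr ?nnegrE.
  rewrite exprMn -[X in _ <= X - _]mulr1 -mulrBr ler_wpM2l ?sqr_ge0//.
  by rewrite lerBrDr.
rewrite /lens_radius; case: ifP => [wl wn|_ wn]; last first.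
  have : 0 <= \sum_(i < n) w 0 (lift ord_max i) ^+ 2.
    by apply: sumr_ge0 => i _; rewrite sqr_ge0.
  by move/le_trans/(_ wn); rewrite ler0N1.
pose s := halfchord t (w 0 ord_max); have s0 : 0 <= s by apply: sqrtr_ge0.
have s1 : 0 < 1 + s by apply: ltr_pwDl.
have s2 : s ^+ 2 = t ^+ 2 - w 0 ord_max ^+ 2.
  by rewrite sqr_sqrtr// subr_ge0 -(real_normK (num_real (w _ _))) ler_sqr ?nnegrE.
pose x : 'rV[R]_n.+1 := \row_i (if unlift ord_max i is Some _ then w 0 i / (1 + s) else 0).
have xlift i : x 0 (lift ord_max i) = w 0 (lift ord_max i) / (1 + s).
  by rewrite mxE liftK.
have xmax : x 0 ord_max = 0 by rewrite mxE unlift_none.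
have wn1 : \sum_(i < n) (w 0 (lift ord_max i) / (1 + s)) ^+ 2 <= 1.
  under eq_bigr do rewrite expr_div_n.
  by rewrite -mulr_suml ler_pdivrMr ?exprn_gt0// mul1r.
have wx : \sum_(i < n) (w 0 (lift ord_max i) - x 0 (lift ord_max i)) ^+ 2 +
     (w 0 ord_max - x 0 ord_max) ^+ 2 <= t ^+ 2.
  rewrite xmax subr0 -lerBrDr -s2.
  under eq_bigr => i _.
    rewrite xlift (_ : _ - _ = s * (w 0 (lift ord_max i) / (1 + s))); last first.
      by field; rewrite gt_eqF.
    rewrite exprMn; over.
  by rewrite -mulr_sumr ler_piMr ?sqr_ge0.
exists x.
  split=> //; rewrite unit_ballE.
  by under eq_bigr do rewrite mxE xlift.
exists (\row_i ((w 0 i - x 0 i) / t)).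
  have yE i : (\row_j ((w 0 j - x 0 j) / t) : 'rV_n.+1) 0 i = (w 0 i - x 0 i) / t.
    by rewrite mxE.
  rewrite unit_ball_split yE expr_div_n.
  under eq_bigr do rewrite yE expr_div_n.
  rewrite -mulr_suml -mulrDl.
  have [->|tn0] := eqVneq t 0; first by rewrite expr0n invr0 mulr0.
  by rewrite ler_pdivrMr ?mul1r// exprn_gt0// lt_neqAle eq_sym tn0.
apply/rowP => i; rewrite [LHS]mxE [X in _ + X]mxE [X in _ * X]mxE.
have [tz|tn0] := eqVneq t 0; last by rewrite mulrC divfK// addrC subrK.
rewrite tz mul0r addr0; apply/esym/eqP; rewrite -subr_eq0.
move: wx; rewrite tz expr0n/= => wx.
case: (unliftP ord_max i) => [j ->|->]; last first.
  rewrite -sqrf_eq0 eq_le sqr_ge0 andbT; apply: le_trans wx.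
  by rewrite lerDr sumr_ge0// => k _; rewrite sqr_ge0.
apply/eqP; apply: (@sum_sqr_le0 n (fun j => w 0 (lift ord_max j) - x 0 (lift ord_max j))).
by apply: le_trans wx; rewrite lerDl sqr_ge0.
Qed.

End ParallelBodies.

(** * Ball constants and volume polynomials *)

Section KappaTheory.
Variable R : realType.
Local Notation mu := (@lebesgue_measure R).
Local Notation kappa := (@kappa R).

Let halfchordX_continuous k : {within `[-1, 1], continuous (fun s : R => halfchord 1 s ^+ k)}.
Proof.
apply: continuous_subspaceT => s.
apply: (@continuous_comp _ _ _ (halfchord 1) (fun y : R => y ^+ k)); last exact: exprn_continuous.
exact: continuous_halfchord.
Qed.

Let N11 : -1 < 1 :> R. Proof. by lra. Qed.

Let halfchord_gt0 (s : R) : -1 < s < 1 -> 0 < 1 ^+ 2 - s ^+ 2.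
Proof. by move=> /andP[s1 s2]; nra. Qed.

Lemma kappa_gt0 k : 0 < kappa k.
Proof.
apply: Rintegral_segment_gt0 => // s /halfchord_gt0 s0.
by rewrite exprn_gt0// sqrtr_gt0.
Qed.

Lemma kappa0 : kappa 0 = 2.
Proof.
transitivity (\int[mu]_(s in `[-1, 1]) ('X : {poly R})^`().[s]).
  by apply: eq_Rintegral => s _; rewrite expr0 derivX hornerC.
by rewrite Rintegral_deriv_poly// !hornerX opprK.
Qed.

(** Integration by parts: the derivative of s (1 - s^2)^((k+2)/2) is
    (k+3) (1 - s^2)^((k+2)/2) - (k+2) (1 - s^2)^(k/2). *)
Lemma kappaSS k : k.+3%:R * kappa k.+2 = k.+2%:R * kappa k.
Proof.
pose F : R -> R := id * (halfchord 1) ^+ k.+2.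
have FE x : F x = x * halfchord 1 x ^+ k.+2 by rewrite /F !fctE.
have cF : {within `[-1, 1], continuous F}.
  move=> x; rewrite (_ : F = fun x => x * halfchord 1 x ^+ k.+2); last exact/funext.
  apply: cvgM; last exact: halfchordX_continuous.
  by move: x; apply: continuous_subspaceT => x; exact: cvg_id.
have ch : {within `[-1, 1], continuous (fun s : R => k.+3%:R * halfchord 1 s ^+ k.+2
    - k.+2%:R * halfchord 1 s ^+ k)}.
  by move=> x; apply: cvgB; apply: cvgM; try exact: cvg_cst; exact: halfchordX_continuous.
have dF (x : R) : -1 < x < 1 -> is_derive x 1 F (k.+3%:R * halfchord 1 x ^+ k.+2
    - k.+2%:R * halfchord 1 x ^+ k).
  move=> /halfchord_gt0 x1.
  have dq : is_derive x 1 (fun s : R => 1 ^+ 2 - s ^+ 2) (- (2 * x)).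
    have := is_deriveB (is_derive_cst (1 ^+ 2 : R) x (1 : R)) (is_deriveX 2 (is_derive_id x (1 : R))).
    by rewrite sub0r /GRing.scale/= mulr1 expr1.
  have dh : is_derive x 1 (halfchord 1) (- x / halfchord 1 x).
    have := @is_derive1_comp R Num.sqrt (fun s : R => 1 ^+ 2 - s ^+ 2) x _ _ (is_derive1_sqrt x1) dq.
    congr (is_derive _ _ _ _); rewrite -/(halfchord 1 x).
    have : halfchord 1 x != 0 by rewrite gt_eqF// sqrtr_gt0.
    by move: (halfchord 1 x) => h h0; field.
  have := is_deriveM (is_derive_id x (1 : R)) (is_deriveX k.+2 dh).
  congr (is_derive _ _ _ _); rewrite !fctE succnK.
  have scE (u v : R) : u *: (v : R^o) = u * v by [].
  rewrite !scE mulr1.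
  have h0 : halfchord 1 x != 0 by rewrite gt_eqF// sqrtr_gt0.
  have h2 : halfchord 1 x ^+ 2 = 1 - x ^+ 2 by rewrite sqr_sqrtr ?expr1n// ltW// -(expr1n _ 2).
  rewrite -[k.+3%:R]natr1 ![_ ^+ k.+2]exprS ![_ ^+ k.+1]exprS.
  move: (halfchord 1 x) h0 h2 => h h0 h2.
    transitivity (h * (h * h ^+ k) - k.+2%:R * x ^+ 2 * h ^+ k); first by field.
  have -> : x ^+ 2 = 1 - h ^+ 2 by rewrite h2 opprB addrCA subrr addr0.
  by ring.
have := segment_FTC N11 ch cF dF.
have h1 : halfchord 1 1 = 0 :> R by rewrite /halfchord subrr sqrtr0.
have hN1 : halfchord 1 (-1) = 0 :> R by rewrite /halfchord sqrrN subrr sqrtr0.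
rewrite !FE h1 hN1 expr0n/= !mulr0 subr0.
have iZ j (r : R) : mu.-integrable `[-1, 1] (EFin \o (fun x : R => r * halfchord 1 x ^+ j)).
  apply: integrable_segment => x; apply: cvgM; [exact: cvg_cst|exact: halfchordX_continuous].
have iS j := integrable_segment (@halfchordX_continuous j).
by rewrite RintegralB// !RintegralZl// => /eqP; rewrite subr_eq0 => /eqP.
Qed.

(** The value is 2 pi.  That it does not depend on k is what turns the products
    [omega] into powers for the cubes. *)
Lemma kappa_product k : k.+2%:R * kappa k.+1 * kappa k = 4 * kappa 1.
Proof.
elim: k => [|k IH]; first by rewrite kappa0; ring.
by rewrite kappaSS -IH; ring.
Qed.

(** The volume of the unit ball of dimension k. *)
Definition omega k : R := \prod_(j < k) kappa j.

Lemma omegaS k : omega k.+1 = omega k * kappa k.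
Proof. by rewrite /omega big_ord_recr. Qed.

Lemma omega_gt0 k : 0 < omega k.
Proof. by apply: prodr_gt0 => j _; apply: kappa_gt0. Qed.

Lemma spherical_omega k : spherical (omega k *: 'X^k) = omega k.+1 *: 'X^(k.+1).
Proof.
apply/polyP => -[|j]; first by rewrite /spherical coefXM coefZ coefXn mulr0.
by rewrite coef_spherical !coefZ !coefXn eqSS omegaS; case: eqVneq => [->|_];
  rewrite ?mulr1 ?mulr0 ?mul0r.
Qed.

End KappaTheory.

Section Volumes.
Variable R : realType.
Local Notation mu := (@lebesgue_measure R).
Implicit Types (t r : R).

Lemma volume_ball n r : volume (sublevel (n := n) (fun _ x => x ^+ 2) r) =
  (truncated_value (omega R n *: 'X^n) r)%:E.
Proof.
elim: n r => [|n IH] r.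
  by rewrite volume_sublevel0 /omega big_ord0 expr0 scale1r.
by rewrite -spherical_omega; apply: volume_sublevel_sqr.
Qed.

(** The operator 2 + J: the effect of one more factor [-1,1]. *)
Definition thicken (P : {poly R}) := 2 *: P + spherical P.

(** The cubic coordinates come first because slices are taken along the first
    coordinate. *)
Lemma volume_sublevel_thicken m n (g : nat -> R -> R) P r :
  (forall r, volume (sublevel (n := m) (fun i => g (n + i)%N) r) = (truncated_value P r)%:E) ->
  (forall i, (i < n)%N -> g i = excess 1) ->
  volume (sublevel (n := n + m) g r) = (truncated_value (iter n thicken P) r)%:E.
Proof.
elim: n g r => [|n IH] g r Pm g1; first exact: Pm.
rewrite volume_slices iterS -integral_truncated_excess; apply: eq_integral => x _.
rewrite sublevel_slice (IH (fun i => g i.+1)); first by rewrite g1.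
  by move=> r'; rewrite -Pm; congr (volume (sublevel _ _)).
by move=> i ni; apply: g1.
Qed.

(** As J sends omega_m t^m to omega_(m+1) t^(m+1), the binomial expansion of
    (2 + J)^n gives the coefficients. *)
Let coef_iter_thicken_full m n j : (iter n thicken (omega R m *: 'X^m))`_j =
  if (j < m)%N then 0 else 'C(n, j - m)%:R * 2 ^+ n / 2 ^+ (j - m) * omega R j.
Proof.
elim: n j => [|n IH] j.
  rewrite /= coefZ coefXn; case: ltngtP => [jm|mj|->]; first by rewrite mulr0.
    by rewrite mulr0 bin_small ?subn_gt0// !mul0r.
  by rewrite subnn bin0 !expr0 divr1 !mulr1 mul1r.
rewrite iterS coefD coefZ IH; case: j => [|j].
  rewrite /spherical coefXM addr0; case: m {IH} => [|m]; last by rewrite mulr0.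
  by rewrite /= !subn0 !bin0 exprS !expr0 !divr1; ring.
rewrite coef_spherical IH; case: (ltngtP j.+1 m) => [jm|mj|jm].
- by ring.
- rewrite ltnS in mj; rewrite subSn// binS natrD omegaS exprS.
  by rewrite exprS; field; rewrite expf_neq0.
- by rewrite -jm subnn !bin0 exprS !expr0 !divr1; ring.
Qed.

Lemma coef_iter_thicken m n k :
  (iter n thicken (omega R m *: 'X^m))`_(k + m) = 'C(n, k)%:R * 2 ^+ n / 2 ^+ k * omega R (k + m).
Proof. by rewrite coef_iter_thicken_full ltnNge leq_addl addnK. Qed.

Lemma measurable_truncated_value P : measurable_fun [set: R] (truncated_value P).
Proof.
have -> : truncated_value P = (fun r => P.[Num.sqrt r] * \1_(`[0, +oo[%classic : set R) r).
  apply/funext => r; rewrite /truncated_value indicE mem_setE in_itv/= andbT.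
  by case: ifP; rewrite ?mulr1 ?mulr0.
apply: measurable_funM; last exact: measurable_indic.
apply: continuous_measurable_fun => r.
by apply: (@continuous_comp _ _ _ Num.sqrt (horner P));
  [exact: sqrt_continuous|exact: continuous_horner].
Qed.

Lemma revolved_slice n (h : R -> R) r x :
  [set y | revolved h r (cons_row x y)] = @revolved R n h (r + x ^+ 2).
Proof.
rewrite /revolved; apply/seteqP.
have e0 : lift ord_max ord0 = ord0 :> 'I_n.+2 by apply/val_inj.
have em : ord_max = lift ord0 ord_max :> 'I_n.+2 by apply/val_inj.
have el (i : 'I_n) : lift ord_max (lift ord0 i) = lift ord0 (lift ord_max i) :> 'I_n.+2.
  by apply/val_inj; rewrite /= /bump; have := ltn_ord i; lia.
have E y : \sum_(i < n.+1) cons_row x y 0 (lift ord_max i) ^+ 2 + r =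
    \sum_(i < n) y 0 (lift ord_max i) ^+ 2 + (r + x ^+ 2).
  rewrite big_ord_recl e0 cons_row0; under eq_bigr do rewrite el cons_rowS.
  by ring.
by split => y /=; rewrite E em cons_rowS.
Qed.

(** Slicing removes the first coordinates, but the profile [h] depends on the last
    one: Tonelli's theorem exchanges the integral over a sliced coordinate with
    the integral over the height z. *)
Lemma volume_revolved n (h : R -> R) r : measurable_fun setT h ->
  volume (@revolved R n h r) =
  (\int[mu]_z (truncated_value (omega R n *: 'X^n) (h z - r))%:E)%E.
Proof.
move=> mh; elim: n r => [|n IH] r.
  rewrite volume_slices; apply: eq_integral => z _.
  rewrite volume0 /truncated_value hornerZ hornerXn expr0 mulr1 /omega big_ord0 subr_ge0.
  have -> : (\1_[set y | @revolved R 0%N h r (cons_row z y)] (0 : 'rV[R]_0) : R) = ((r <= h z)%R)%:R.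
    rewrite indicE; congr (nat_of_bool _)%:R.
    have e : (ord_max : 'I_1) = ord0 by apply/val_inj.
    by apply/idP/idP; rewrite inE/= /revolved /= big_ord0 add0r e cons_row0.
  by case: (r <= h z).
rewrite volume_slices.
transitivity (\int[mu]_x \int[mu]_z (truncated_value (omega R n *: 'X^n) (h z - r - x ^+ 2))%:E)%E.
  apply: eq_integral => x _.
  have -> : [set y | revolved h r (cons_row x y)] = @revolved R n h (r + x ^+ 2).
    exact: revolved_slice.
  by rewrite IH; apply: eq_integral => z _; rewrite opprD addrA.
have mT := measurable_truncated_value (omega R n *: 'X^n).
rewrite (@fubini_tonelli _ _ _ _ _ mu mu (fun p : R * R =>
  (truncated_value (omega R n *: 'X^n) (h p.2 - r - p.1 ^+ 2))%:E))//=.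
- by apply: eq_integral => z _; rewrite integral_truncated_sqr spherical_omega.
- apply/measurable_EFinP; apply: (measurableT_comp mT).
  apply: measurable_funB.
    apply: measurable_funB => //.
    exact: (measurableT_comp mh measurable_snd).
  apply: measurable_funX; exact: measurable_fst.
- move=> p; rewrite lee_fin /truncated_value; case: ifP => // _.
  by rewrite hornerZ hornerXn mulr_ge0 ?exprn_ge0 ?sqrtr_ge0// ltW ?omega_gt0.
Qed.

End Volumes.

(** * Minkowski polynomials of the four bodies *)

Section MinkowskiPolynomials.
Variable R : realType.
Local Notation mu := (@lebesgue_measure R).

Lemma poly_eq_on_nonneg (p q : {poly R}) : (forall t, 0 <= t -> p.[t] = q.[t]) -> p = q.
Proof.
move=> pq; apply/eqP; rewrite -subr_eq0; apply/negPn/negP => d0.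
have := @max_poly_roots R (p - q) [seq i%:R | i <- iota 0 (size (p - q))] d0.
rewrite size_map size_iota ltnn => h; apply: (notF (h _ _)).
  by apply/allP => _ /mapP[i _ ->]; rewrite rootE hornerD hornerN pq ?subrr.
by rewrite map_inj_uniq ?iota_uniq// => i j /eqP; rewrite eqr_nat => /eqP.
Qed.

Lemma minkowski_polyE n (U : set 'rV[R]_n) (M : {poly R}) : (size M <= n.+1)%N ->
  (forall t, 0 <= t -> volume (parallel_body U t) = (M.[t])%:E) -> minkowski_poly U = M.
Proof.
move=> sM MU; rewrite /minkowski_poly; case: xgetP => [_ -> [_ VU]|/(_ M) []//].
by apply: poly_eq_on_nonneg => t t0; apply: EFin_inj; rewrite -VU// MU.
Qed.

Lemma minkowski_ball n :
  minkowski_poly (@unit_ball R n) = omega R n *: (1 + 1 *: 'X) ^+ n.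
Proof.
apply: minkowski_polyE => [|t t0].
  apply/leq_sizeP => j nj; rewrite coefZ coef_binomial bin_small//.
  by rewrite mul0r mulr0.
rewrite parallel_ball// volume_ball /truncated_value sqr_ge0 sqrtr_sqr ger0_norm ?addr_ge0//.
by rewrite hornerZ hornerXn hornerZ horner_exp hornerD hornerC hornerZ hornerX mul1r.
Qed.

Let size_thicken m n : (size (iter n (@thicken R) (omega R m *: 'X^m)) <= (n + m).+1)%N.
Proof.
apply/leq_sizeP => j nj; have mj : (m <= j)%N by lia.
by rewrite -(subnK mj) coef_iter_thicken bin_small ?mul0r//; lia.
Qed.

Lemma minkowski_cube n : minkowski_poly (@unit_cube R n) = iter n (@thicken R) (omega R 0 *: 'X^0).
Proof.
apply: minkowski_polyE => [|t t0]; first by have := size_thicken 0 n; rewrite addn0.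
have := @parallel_box R n (fun=> 1) t (fun=> ler01) t0; rewrite -[box _]/(@unit_cube R n) => ->.
have := @volume_sublevel_thicken R 0 n (fun=> excess 1) (omega R 0 *: 'X^0) (t ^+ 2).
rewrite addn0 => ->//; last first.
  by move=> r; rewrite volume_sublevel0 /omega big_ord0 scale1r expr0.
by rewrite /truncated_value sqr_ge0 sqrtr_sqr ger0_norm.
Qed.

Lemma minkowski_squeezed_cube n : minkowski_poly (squeezed (@unit_cube R n)) =
  iter n (@thicken R) (omega R 1 *: 'X^1).
Proof.
apply: minkowski_polyE => [|t t0]; first by have := size_thicken 1 n; rewrite addn1.
pose b i : R := if (i < n)%N then 1 else 0.
have b0 i : 0 <= b i by rewrite /b; case: ifP.
have -> : squeezed (@unit_cube R n) = @box R n.+1 b.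
  apply/seteqP; split => x.
    move=> [xb xl] i; case: (unliftP ord_max i) => [j ->|->].
      by have := xb j; rewrite mxE /b lift_max ltn_ord.
    by rewrite xl normr0 b0.
  move=> xb; split=> [k|].
    by have := xb (lift ord_max k); rewrite mxE /b lift_max ltn_ord.
  by apply/eqP; rewrite -normr_le0; have := xb ord_max; rewrite /b ltnn.
rewrite parallel_box//.
have := @volume_sublevel_thicken R 1 n (fun i => excess (b i)) (omega R 1 *: 'X^1) (t ^+ 2).
rewrite addn1 => ->.
- by rewrite /truncated_value sqr_ge0 sqrtr_sqr ger0_norm.
- move=> r; rewrite -spherical_omega; apply: volume_sublevel_sqr => [x|s].
    by rewrite addn0 /b ltnn excess0.
  by rewrite volume_sublevel0 /omega big_ord0 scale1r expr0.
- by move=> i ni; rewrite /b ni.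
Qed.

Lemma measurable_lens_radius t : measurable_fun [set: R] (lens_radius t).
Proof.
have -> : lens_radius t =
    (fun z => ((1 + halfchord t z) ^+ 2 + 1) * \1_(`[- t, t]%classic : set R) z - 1).
  apply/funext => z; rewrite /lens_radius indicE mem_setE in_itv/= -ler_norml.
  by case: ifP => _; rewrite ?mulr1 ?addrK// mulr0 sub0r.
apply: measurable_funB => //; apply: measurable_funM; last exact: measurable_indic.
apply: continuous_measurable_fun => z; apply: cvgD; last exact: cvg_cst.
apply: (@continuous_comp _ _ _ (fun z => 1 + halfchord t z) (fun y : R => y ^+ 2)).
  by apply: cvgD; [exact: cvg_cst|exact: continuous_halfchord].
exact: exprn_continuous.
Qed.

Lemma minkowski_squeezed_ball n : minkowski_poly (squeezed (@unit_ball R n)) =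
  spherical (omega R n *: (1 + 1 *: 'X) ^+ n).
Proof.
apply: minkowski_polyE => [|t t0].
  apply/leq_sizeP => -[//|j] nj; rewrite coef_spherical coefZ coef_binomial bin_small//.
  by rewrite !(mul0r, mulr0).
rewrite parallel_squeezed_ball// volume_revolved; last exact: measurable_lens_radius.
rewrite -integral_halfchord// -integral_segment_EFin; last first.
  by apply: continuous_subspaceT; apply: continuous_horner_halfchord.
rewrite [RHS]integral_mkcond; apply: eq_integral => z _.
rewrite /patch mem_setE in_itv/= -ler_norml subr0 /truncated_value /lens_radius.
case: (`|z| <= t); last by rewrite ler0N1.
rewrite sqr_ge0 sqrtr_sqr ger0_norm ?addr_ge0 ?sqrtr_ge0//.
by rewrite hornerZ hornerXn hornerZ horner_exp hornerD hornerC hornerZ hornerX mul1r.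
Qed.

End MinkowskiPolynomials.

(** * Weyl polynomials *)

Section WeylCoefficients.
Variable R : realType.

Lemma mup_simple (F : fieldType) (P : {poly F}) z : P != 0 -> root P z -> P^`().[z] != 0 ->
  mup z P = 1%N.
Proof.
move=> P0 rz dz; apply/eqP; rewrite eqn_leq mup_leq// mup_geq// expr1 dvdp_XsubCl rz andbT.
apply: contraNN dz => /dvdpP[s ->].
by rewrite expr2 !derivM derivXsubC mul1r mulr1 !(hornerXsubC, hornerM, hornerD)
  subrr !(mulr0, addr0).
Qed.

Lemma conservative_even_lift (q : {poly R}) : axial (even_lift q) -> q`_0 != 0 ->
  conservative (q \Po 'X^2).
Proof.
move=> axq q0 PC z; rewrite {}/PC -/(even_lift q) => rz.
have z0 : z != 0.
  apply: contraNneq q0 => z0; move/rootP: rz.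
  by rewrite even_liftE z0 expr0n/= horner_coef0 coef_map => /eqP; rewrite fmorph_eq0.
by have [rez dz] := axq z z0 rz; rewrite mup_simple// axial_neq0.
Qed.

(** The factor Gamma(l + 3/2)/Gamma(3/2) contributes (2l+1)!! / 2^l. *)
Lemma gamma_odd_fact l :
  2 ^+ l * (Gamma (l%:R + 2^-1 + 1) / Gamma (2^-1 + 1 : R)) = odd_fact R l.+1.
Proof.
have G0 : Gamma (2^-1 + 1 : R) != 0 by rewrite gt_eqF// Gamma_gt0//; lra.
elim: l => [|l IH].
  by rewrite add0r expr0 mulfV// /odd_fact big_ord1 mulr1.
rewrite /odd_fact big_ord_recr/= -/(odd_fact R l.+1) -IH.
have -> : l.+1%:R + 2^-1 + 1 = (l%:R + 2^-1 + 1) + 1 :> R by rewrite -natr1; ring.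
rewrite GammaS; last by have := ler0n R l; lra.
have -> : l.+1.*2.+1%:R = 2 * (l%:R + 2^-1 + 1) :> R.
  by rewrite -muln2 -[LHS]natr1 natrM -[l.+1%:R]natr1; field.
by rewrite exprS; ring.
Qed.

Lemma gamma_rising (p l : nat) : (0 < p)%N ->
  2 ^- l * Gamma (p%:R / 2 + 1) / Gamma (p%:R / 2 + l%:R + 1) = (rising (p%:R : R) l)^-1.
Proof.
move=> p0; have p1 : 1 <= p%:R :> R by rewrite ler1n.
have Gp k : 0 < Gamma (p%:R / 2 + k%:R + 1 : R) by apply: Gamma_gt0; have := ler0n R k; lra.
elim: l => [|l IH].
  rewrite addr0 expr0 invr1 mul1r mulfV ?gt_eqF//; first by rewrite /rising big_ord0 invr1.
  by have := Gp 0%N; rewrite addr0.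
rewrite risingS invfM -IH.
have -> : p%:R / 2 + l.+1%:R + 1 = (p%:R / 2 + l%:R + 1) + 1 :> R by rewrite -natr1; ring.
have l0 := ler0n R l.
rewrite (@GammaS _ (_ + l%:R + 1)); last by lra.
have -> : p%:R + l.+1.*2%:R = 2 * (p%:R / 2 + l%:R + 1) :> R.
  by rewrite -muln2 natrM -natr1; field.
rewrite exprS !invfM; ring.
Qed.

Lemma poly_comp_sqr m (a : nat -> R) :
  \sum_(0 <= l < m) a l *: 'X^(l.*2) = (\poly_(l < m) a l) \Po 'X^2.
Proof.
rewrite big_mkord poly_def linear_sum/=; apply: eq_bigr => l _.
by rewrite comp_polyZ comp_Xn_poly -exprM mul2n.
Qed.

Lemma conservative_weyl_poly n p (U : set 'rV[R]_n.+1) (c : R) (a : nat -> R) : (0 < p)%N ->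
  c != 0 -> a 0%N != 0 ->
  (forall l, weyl_coef U l / rising p%:R l = c * a l) ->
  axial (even_lift (\poly_(l < (n./2).+1) a l)) -> conservative (weyl_poly p U).
Proof.
move=> p0 c0 a0 aU axa.
have -> : weyl_poly p U = (c *: \poly_(l < (n./2).+1) a l) \Po 'X^2.
  rewrite comp_polyZ -poly_comp_sqr scaler_sumr; apply: eq_bigr => l _.
  by rewrite gamma_rising// [_^-1 * _]mulrC aU scalerA.
apply: conservative_even_lift; last by rewrite coefZ coef_poly mulf_neq0.
by rewrite even_liftZ; apply: axialZ => //; rewrite fmorph_eq0.
Qed.

Lemma conservative_weyl_polys n (U : set 'rV[R]_n.+1) (c : R) (a : nat -> R) :
  c != 0 -> a 0%N != 0 ->
  (forall l, weyl_coef U l = c * a l) ->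
  axial (even_lift (\poly_(l < (n./2).+1) a l)) ->
  conservative (weyl_poly_infty U) /\
  (forall p, (1 <= p)%N -> conservative (weyl_poly p U)).
Proof.
move=> c0 a0 aU axa; split=> [|p p0].
  have -> : weyl_poly_infty U = (c *: \poly_(l < (n./2).+1) a l) \Po 'X^2.
    rewrite comp_polyZ -poly_comp_sqr scaler_sumr; apply: eq_bigr => l _.
    by rewrite aU scalerA.
  apply: conservative_even_lift; last by rewrite coefZ coef_poly mulf_neq0.
  by rewrite even_liftZ; apply: axialZ => //; rewrite fmorph_eq0.
apply: (@conservative_weyl_poly n p U c (fun l => a l / rising p%:R l)) => //.
- by rewrite /rising big_ord0 divr1.
- by move=> l; rewrite aU mulrA.
have -> : \poly_(l < (n./2).+1) (a l / rising p%:R l) =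
    weyl_multiplier p%:R (\poly_(l < (n./2).+1) a l).
  apply/polyP => l; rewrite coef_weyl_multiplier !coef_poly.
  by case: ifP => //; rewrite mul0r.
apply: axial_weyl_multiplier => //; by rewrite coef_poly.
Qed.

Lemma weyl_coefE n (U : set 'rV[R]_n.+1) l :
  weyl_coef U l = odd_fact R l.+1 * (minkowski_poly U)`_l.*2.+1.
Proof. by rewrite /weyl_coef gamma_odd_fact. Qed.

Lemma odd_factS l : odd_fact R l.+1 = odd_fact R l * l.*2.+1%:R.
Proof. by rewrite /odd_fact big_ord_recr. Qed.

Lemma odd_fact_omega l :
  odd_fact R l.+1 * omega R l.*2.+1 = 2 * (2 * Num.sqrt (kappa R 1)) ^+ l.*2.
Proof.
have -> : (2 * Num.sqrt (kappa R 1)) ^+ l.*2 = (4 * kappa R 1) ^+ l.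
  rewrite -mul2n exprM [(2 * _) ^+ 2]exprMn sqr_sqrtr ?ltW ?kappa_gt0//.
  by congr ((_ * _) ^+ _); ring.
elim: l => [|l IH].
  by rewrite /odd_fact /omega !big_ord1 kappa0 expr0 mul1r mulr1.
rewrite odd_factS doubleS [omega R _.+3]omegaS [omega R _.+2]omegaS exprSr [2 * (_ * _)]mulrA -IH.
by rewrite -(kappa_product _ l.*2.+1); ring.
Qed.

Lemma conservative_ball n : conservative (weyl_poly_infty (@unit_ball R n.+1)) /\
  (forall p, (1 <= p)%N -> conservative (weyl_poly p (@unit_ball R n.+1))).
Proof.
apply: (@conservative_weyl_polys _ _ (omega R n.+1 * n.+1%:R)
  (fun l => 'C(n, l.*2)%:R * odd_fact R l)); last exact: axial_hermite_square.
- by rewrite mulf_neq0 ?pnatr_eq0// gt_eqF// omega_gt0.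
- by rewrite bin0 /odd_fact big_ord0 mulr1 oner_eq0.
move=> l; rewrite weyl_coefE minkowski_ball coefZ coef_binomial expr1n mulr1 odd_factS.
have /(congr1 (fun k => k%:R : R)) := mul_bin_diag n.+1 l.*2; rewrite !natrM/= => e.
by rewrite -[_ * (_ * _) in RHS]mulrA [n.+1%:R * _]mulrA e; ring.
Qed.

Lemma conservative_cube n : conservative (weyl_poly_infty (@unit_cube R n.+1)) /\
  (forall p, (1 <= p)%N -> conservative (weyl_poly p (@unit_cube R n.+1))).
Proof.
pose b := Num.sqrt (kappa R 1); have b0 : 0 < b by rewrite sqrtr_gt0 kappa_gt0.
apply: (@conservative_weyl_polys _ _ (2 ^+ n.+1 / b)
  (fun l => 'C(n.+1, l.*2.+1)%:R * b ^+ l.*2.+1)); last exact: axial_binomial_odd.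
- by rewrite mulf_neq0 ?invr_eq0 ?expf_neq0// gt_eqF.
- by rewrite bin1 expr1 mulf_neq0 ?pnatr_eq0// gt_eqF.
move=> l; rewrite weyl_coefE minkowski_cube.
have := @coef_iter_thicken R 0 n.+1 l.*2.+1; rewrite addn0 => ->.
rewrite mulrCA odd_fact_omega -/b exprMn [2 ^+ l.*2.+1]exprS [b ^+ l.*2.+1]exprS.
by field; rewrite expf_neq0// gt_eqF.
Qed.

Lemma conservative_squeezed_cube n : (0 < n)%N ->
  conservative (weyl_poly_infty (squeezed (@unit_cube R n))) /\
  (forall p, (1 <= p)%N -> conservative (weyl_poly p (squeezed (@unit_cube R n)))).
Proof.
move=> n0; pose b := Num.sqrt (kappa R 1).
have b0 : 0 < b by rewrite sqrtr_gt0 kappa_gt0.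
apply: (@conservative_weyl_polys _ _ (2 ^+ n.+1)
  (fun l => 'C(n, l.*2)%:R * b ^+ l.*2)); last exact: axial_binomial_even.
- by rewrite expf_neq0.
- by rewrite bin0 expr0 mulr1 oner_eq0.
move=> l; rewrite weyl_coefE minkowski_squeezed_cube.
have := @coef_iter_thicken R 1 n l.*2; rewrite addn1 => ->.
rewrite mulrCA odd_fact_omega -/b exprMn [2 ^+ n.+1]exprS.
by field; rewrite expf_neq0.
Qed.

(** For the squeezed ball kappa_(2l) remains next to the factorial; the recursion
    [kappaSS] identifies the quotient by its first-order recursion. *)
Lemma odd_fact_kappa p (b : nat -> R) : (0 < p)%N -> b 0%N = 1 ->
  (forall l, (p + l.+1.*2)%:R * b l.+1 = l.+1.*2%:R * b l) ->
  forall l, odd_fact R l.+1 * kappa R l.*2 / rising p%:R l = 2 * b l.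
Proof.
move=> p0 b0 bS; elim=> [|l IH].
  by rewrite /odd_fact /rising big_ord1 big_ord0 b0 kappa0 divr1 mul1r mulr1.
have pl : (p + l.+1.*2)%:R != 0 :> R by rewrite pnatr_eq0 addn_eq0 gtn_eqF.
have r0 : rising (p%:R : R) l != 0 by rewrite gt_eqF// rising_gt0.
apply: (mulfI pl); rewrite [RHS]mulrCA bS [RHS]mulrCA -IH odd_factS risingS -natrD doubleS.
have e := kappaSS R l.*2.
rewrite -[odd_fact R l.+1 * _ * _]mulrA e.
move: pl; rewrite doubleS; move: (p + _)%:R (rising _ _) r0 => D r r0 D0.
by field; rewrite D0 r0.
Qed.

(** What depends on p is only the solution [b] of the recursion, and a proof
    that the binomial sum with these weights is axial. *)
Lemma conservative_squeezed_ball n p (b : nat -> R) : (0 < p)%N -> b 0%N = 1 ->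
  (forall l, (p + l.+1.*2)%:R * b l.+1 = l.+1.*2%:R * b l) ->
  axial (even_lift (\poly_(l < (n./2).+1) ('C(n, l.*2)%:R * b l))) ->
  conservative (weyl_poly p (squeezed (@unit_ball R n))).
Proof.
move=> p0 b0 bS; apply: (@conservative_weyl_poly _ _ _ (2 * omega R n)) => //.
- by rewrite mulf_neq0// gt_eqF// omega_gt0.
- by rewrite bin0 b0 mulr1 oner_eq0.
move=> l; rewrite weyl_coefE minkowski_squeezed_ball coef_spherical coefZ coef_binomial.
rewrite expr1n mulr1.
have -> : 2 * omega R n * ('C(n, l.*2)%:R * b l) = omega R n * 'C(n, l.*2)%:R * (2 * b l).
  by ring.
by rewrite -(odd_fact_kappa p0 b0 bS); ring.
Qed.

End WeylCoefficients.

Theorem theorem2p5 (R : realType) (n : nat) (hn : (1 <= n)%N) :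
  [/\ conservative (weyl_poly_infty (@unit_ball R n.+1)) /\
      (forall p : nat, (1 <= p)%N ->
         conservative (weyl_poly p (@unit_ball R n.+1))),
      [/\ conservative (weyl_poly 1 (squeezed (@unit_ball R n))),
          conservative (weyl_poly 2 (squeezed (@unit_ball R n))) &
          conservative (weyl_poly 4 (squeezed (@unit_ball R n)))],
      conservative (weyl_poly_infty (@unit_cube R n.+1)) /\
      (forall p : nat, (1 <= p)%N ->
         conservative (weyl_poly p (@unit_cube R n.+1))) &
      conservative (weyl_poly_infty (squeezed (@unit_cube R n))) /\
      (forall p : nat, (1 <= p)%N ->
         conservative (weyl_poly p (squeezed (@unit_cube R n))))].
Proof.
split; [exact: conservative_ball| |exact: conservative_cube|exact: conservative_squeezed_cube].
split.
- apply: (@conservative_squeezed_ball R n 1 (fun l => kappa R l.*2 / 2)) => //.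
  + by rewrite kappa0 mulfV.
  + by move=> l; rewrite mulrA doubleS kappaSS mulrA.
  apply: axial_kernel1 => //; first by rewrite kappa0 mulfV.
  by move=> l; rewrite mulrA doubleS kappaSS mulrA.
- apply: (@conservative_squeezed_ball R n 2 (fun l => l.+1%:R^-1)) => //.
  + by rewrite invr1.
  + move=> l; rewrite -[(2 + _)%N]/(l.+2.*2) -!muln2 !natrM.
    by have l0 := ler0n R l; field; apply/andP; split; rewrite lt0r_neq0//; lra.
  exact: axial_kernel2.
- apply: (@conservative_squeezed_ball R n 4 (fun l => 2 / (l.+1 * l.+2)%:R)) => //.
  + by rewrite mul1n mulfV.
  + move=> l; rewrite -[(4 + _)%N]/(l.+3.*2) -!muln2 !natrM.
    by have l0 := ler0n R l; field; rewrite !lt0r_neq0//; lra.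
  exact: axial_kernel4.
Qed.
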